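(* Let $0\le\alpha<nd$, let $\sigma_{1},\dots,\sigma_{n},\omega$ be weights on $\mathbb{R}^{d}$, let $\Phi_{1},\dots,\Phi_{n} \in \widetilde{\mathcal{U}}\cap \nabla_{2}$, $\Psi \in \widetilde{\mathcal{U}}$, and let $\Phi$ be a bijection from $\mathbb{R}_{+}$ to itself such that $\Phi^{-1}=\Phi_{1}^{-1}\times\cdots\times \Phi_{n}^{-1}$ (pointwise product), and suppose that $t\mapsto \frac{\Psi(t)}{\Phi_i(t)}$ is increasing on $\mathbb{R}_{+}^{*}$ for each $i\in\{1,2,\dots,n\}$. Put $$[\vec{\sigma},\omega]_{A_{\vec{\Phi},\Psi}^{\alpha}}:=\sup_{Q\in \mathcal{Q}}\omega(Q)\Psi\left(\prod_{i=1}^{n}\frac{\sigma_{i}(Q)}{|Q|^{1-\frac{\alpha}{nd}}}\right)\Psi \left(\prod_{i=1}^{n}\Phi_{i}^{-1}\left(\frac{1}{\sigma_{i}(Q)}\right)\right).$$ If $[\vec{\sigma},\omega]_{A_{\vec{\Phi},\Psi}^{\alpha}}<\infty$ and $\sigma_{i} \in \mathcal{A}_\infty$ for $1\leq i \leq n$, then there exists a constant $C>0$, depending only on $n,\Psi,\Phi_{1},\dots,\Phi_{n}$ (and on the fixed parameters $d,\alpha$), such that for any $(f_{1},\dots,f_{n}) \in L^{\Phi_{1}}(\sigma_{1})\times\cdots\times L^{\Phi_{n}}(\sigma_{n})$, $$\|\mathcal{M}_{\alpha}(\sigma_{1}f_{1},\dots,\sigma_{n}f_{n}) \|_{L_{\omega}^{\Psi}}^{lux}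 \leq C\, \Psi^{-1}\left([\vec{\sigma},\omega]_{A_{\vec{\Phi},\Psi}^{\alpha}}\prod_{i=1}^{n}[\sigma_{i}]_{\mathcal{A}_\infty}^{q_i}\right)\prod_{i=1}^{n}\|f_{i}\|_{L_{\sigma_{i}}^{\Phi_{i}}}^{lux},$$ where $q_i$ is the upper-type of $\Psi\circ\Phi_i^{-1}$ (i.e. $q_i\ge1$ is an exponent such that $\Psi\circ\Phi_i^{-1}$ is of upper-type $q_i$).
   Context: $\mathbb{R}_+=[0,\infty)$, $\mathbb{R}_+^*=(0,\infty)$. $\mathcal{Q}$ is the set of non-degenerate cubes in $\mathbb{R}^d$ with sides parallel to the axes; $|Q|$ is Lebesgue measure. A weight is a locally integrable, almost everywhere positive function $\sigma$ on $\mathbb{R}^d$; $\sigma(E)=\int_E\sigma(x)\,dx$. Maximal functions: for $0\le\alpha<nd$, $\mathcal{M}_\alpha(f_1,\dots,f_n)(x):=\sup_{Q\in \mathcal{Q}}|Q|^{\alpha /d}\prod_{i=1}^n\frac{\chi_Q(x)}{|Q|}\int_Q|f_i(y)|\,dy$; for a single function, $\mathcal{M}f(x):=\sup_{Q\in\mathcal{Q}}\frac{\chi_Q(x)}{|Q|}\int_Q|f(y)|dy$. A weight $\omega$ belongs to $\mathcal{A}_\infty$ if $[\omega]_{\mathcal{A}_\infty}:=\sup_{Q\in \mathcal{Q}}\frac{1}{\omega(Q)}\int_Q\mathcal{M}(\omega\chi_Q)(x)\,dx<\infty$. A growth function is a function $\Phi:\mathbb{R}_+\to\mathbb{R}_+$,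 not identically zero, continuous, nondecreasing and onto. It is of upper-type $q>0$ if there is $C_q>0$ with $\Phi(st)\le C_q t^q\Phi(s)$ for all $s>0$, $t\ge 1$. For $q\ge1$, $\mathcal{U}^q$ is the set of growth functions of upper-type $q$ such that $t\mapsto\Phi(t)/t$ is nondecreasing on $\mathbb{R}_+^*$; $\mathcal{U}=\bigcup_{q\ge1}\mathcal{U}^q$. Standing convention: (up to replacing it by an equivalent function) every $\Phi\in\mathcal{U}$ is assumed convex, of class $C^1$, with $\Phi'(t)\approx\Phi(t)/t$ for $t>0$. $\Phi\in\Delta'$: there is $C>0$ with $\Phi(st)\le C\Phi(s)\Phi(t)$ for all $s,t>0$. $\Phi\in\Delta_2$: there is $K>0$ with $\Phi(2t)\le K\Phi(t)$ for all $t>0$. For a convex growth function $\Phi\in\Delta_2$, $\Phi\in\nabla_2$ means there is $C>0$ with $\int_0^t\frac{\Phi(s)}{s^2}ds\le C\frac{\Phi(t)}{t}$ for all $t>0$. For $q\ge1$, $\widetilde{\mathcal{U}}^q$ is the set of $\Phi\in\mathcal{U}^q\cap\Delta'$ for which there is $C>0$ with $\Phi(s/t)\le C\,\Phi(s)/t^q$ for all $s,t\ge1$; $\widetilde{\mathcal{U}}=\bigcup_{q\ge1}\widetilde{\mathcal{U}}^q$. For $\Phi\in\mathcal{U}$ and a weight $\sigma$, $L^\Phi(\sigma)$ is the set of (classes of) measurable $f:\mathbb{R}^d\to\mathbb{C}$ with $\|f\|_{L^\Phi_\sigma}^{lux}:=\inf\{\lambda>0:\int_{\mathbb{R}^d}\Phi(|f(x)|/\lambda)\sigma(x)dx\le1\}<\infty$.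 *)

(* Defs.v *)
From HB Require Import structures.
From mathcomp Require Import all_boot all_order all_algebra.
From mathcomp Require Import all_classical all_reals all_analysis.
From mathcomp.real_closed Require Import complex.

Set Implicit Arguments.
Unset Strict Implicit.
Unset Printing Implicit Defensive.

Import Order.TTheory GRing.Theory Num.Theory.
Import numFieldNormedType.Exports.

Local Open Scope classical_set_scope.
Local Open Scope ring_scope.
Local Open Scope complex_scope.
Local Open Scope ereal_scope.

Section LebesgueMeasure.
Variable R : realType.
Local Notation Rm := (measurableTypeR R).

Definition consp d (p : Rm * d.-tuple Rm) : d.+1.-tuple Rm :=
  [the d.+1.-tuple Rm of p.1 :: p.2].

Lemma measurable_consp d : measurable_fun [set: Rm * d.-tuple Rm] (@consp d).
Proof. exact: measurable_cons. Qed.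

(* d-fold product of the one-dimensional Lebesgue measure, on Borel sets *)
Fixpoint borel_leb (d : nat) : set (d.-tuple Rm) -> \bar R :=
  match d return set (d.-tuple Rm) -> \bar R with
  | 0 => dirac [tuple]
  | d'.+1 => pushforward (lebesgue_measure \x @borel_leb d') (@consp d')
  end.
Arguments borel_leb d _ : clear implicits.

Section Step.
Variables (d : nat) (m : {sigma_finite_measure set (d.-tuple Rm) -> \bar R}).

Definition leb_step : set (d.+1.-tuple Rm) -> \bar R :=
  pushforward (lebesgue_measure \x m) (@consp d).

Let m12 : {measure set (Rm * d.-tuple Rm) -> \bar R} := lebesgue_measure \x m.

Let step0 : leb_step set0 = 0.
Proof. by rewrite /leb_step /pushforward preimage_set0 (measure0 m12). Qed.

Let step_ge0 A : 0 <= leb_step A.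
Proof. exact: (measure_ge0 m12). Qed.

Let step_sigma_additive : semi_sigma_additive leb_step.
Proof.
move=> F mF tF mUF; rewrite /leb_step /pushforward preimage_bigcup.
apply: (@measure_semi_sigma_additive _ _ _ m12).
- by move=> k; rewrite -[X in measurable X]setTI; exact: measurable_consp.
- apply/trivIsetP => /= i j _ _ ij; rewrite -preimage_setI.
  by move/trivIsetP : tF => /(_ _ _ _ _ ij) ->//; rewrite preimage_set0.
- by rewrite -preimage_bigcup -[X in measurable X]setTI; exact: measurable_consp.
Qed.

HB.instance Definition _ := isMeasure.Build _ _ _ leb_step
  step0 step_ge0 step_sigma_additive.

Let step_sigma_finite : sigma_finite setT leb_step.
Proof.
have [F FT Ffin] := sigma_finiteT (@lebesgue_measure R).
have [G GT Gfin] := sigma_finiteT m.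
pose H (k : nat) : set (d.+1.-tuple Rm) :=
  if @unpickle (nat * nat)%type k is Some (i, j) then
    [set x : d.+1.-tuple Rm | F i (thead x) /\ G j [tuple of behead x]]
  else set0.
have preH i j : @consp d @^-1` [set x : d.+1.-tuple Rm | F i (thead x) /\
    G j [tuple of behead x]] = F i `*` G j.
  have bE (p : Rm * d.-tuple Rm) : [tuple of behead (consp p)] = p.2.
    exact/val_inj.
  by apply/seteqP; split=> p [/= Fp Gp]; split=> //=; move: Gp; rewrite bE.
have mH k : measurable (H k).
  rewrite /H; case: unpickle => [[i j]|]//.
  rewrite (_ : mkset _ = ((@tnth d.+1 Rm ^~ ord0) @^-1` (F i)) `&`
    ((fun x : d.+1.-tuple Rm => [tuple of behead x] : d.-tuple Rm) @^-1` (G j)))//.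
  apply: measurableI; rewrite -[X in measurable X]setTI.
    by apply: measurable_tnth => //; have [] := Ffin i.
  by apply: measurable_behead => //; have [] := Gfin j.
exists H.
  apply/esym; rewrite -subTset => x _.
  have [i _ Fi] : (\bigcup_i F i) (thead x) by rewrite -FT.
  have [j _ Gj] : (\bigcup_j G j) [tuple of behead x] by rewrite -GT.
  by exists (pickle (i, j)) => //; rewrite /H pickleK.
move=> k; split; first exact: mH.
rewrite /H; case: unpickle => [[i j]|]; last by rewrite measure0 ltry.
rewrite /leb_step /pushforward preH product_measure1E//.
- by rewrite lte_mul_pinfty// ?ge0_fin_numE ?measure_ge0//;
    [have [] := Ffin i|have [] := Gfin j].
- by have [] := Ffin i.
- by have [] := Gfin j.
Qed.

HB.instance Definition _ :=
  @Measure_isSigmaFinite.Build _ _ _ leb_step step_sigma_finite.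

Definition leb_step_sfm : {sigma_finite_measure set (d.+1.-tuple Rm) -> \bar R} :=
  leb_step.

End Step.

Lemma borel_leb_sfm d :
  {m : {sigma_finite_measure set (d.-tuple Rm) -> \bar R} |
    m = borel_leb d :> (set _ -> \bar R)}.
Proof.
elim: d => [|d [m mE]]; first by exists (dirac [tuple]).
by exists (leb_step_sfm m); rewrite /= -mE.
Qed.

Section Instances.
Variable d : nat.

Let borel_leb0 : borel_leb d set0 = 0.
Proof. by have [m <-] := borel_leb_sfm d; exact: measure0. Qed.

Let borel_leb_ge0 A : 0 <= borel_leb d A.
Proof. by have [m <-] := borel_leb_sfm d; exact: measure_ge0. Qed.

Let borel_leb_sigma_additive : semi_sigma_additive (borel_leb d).
Proof.
by have [m <-] := borel_leb_sfm d; exact: measure_semi_sigma_additive.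
Qed.

HB.instance Definition _ := isMeasure.Build _ _ _ (borel_leb d)
  borel_leb0 borel_leb_ge0 borel_leb_sigma_additive.

Let borel_leb_sigma_finite : sigma_finite setT (borel_leb d).
Proof. by have [m <-] := borel_leb_sfm d; exact: sigma_finiteT. Qed.

HB.instance Definition _ :=
  @Measure_isSigmaFinite.Build _ _ _ (borel_leb d) borel_leb_sigma_finite.

End Instances.

Definition borel_cube d (a : d.-tuple R) (l : R) : set (d.-tuple Rm) :=
  [set x | forall i, (tnth a i <= tnth x i <= tnth a i + l)%R].

Lemma measurable_borel_cube d (a : d.-tuple R) (l : R) :
  measurable (borel_cube a l).
Proof.
rewrite (_ : borel_cube a l = \big[setI/setT]_(i < d)
    ((@tnth d Rm ^~ i) @^-1` [set` `[tnth a i, (tnth a i + l)%R]])).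
  apply: bigsetI_measurable => i _; rewrite -[X in measurable X]setTI.
  exact: measurable_tnth.
rewrite -bigcap_seq; apply/seteqP; split=> x /= xa i; first by move=> _; exact: xa.
by have := xa i (mem_index_enum i); rewrite ?in_itv.
Qed.

Lemma borel_leb_cube d (a : d.-tuple R) (l : R) : (0 < l)%R ->
  borel_leb d (borel_cube a l) = (l ^+ d)%:E.
Proof.
move=> l0; elim: d a => [|d IH] a.
  by rewrite /= diracE expr0 mem_set// => -[].
case/tupleP: a => a0 a; rewrite [LHS]/= /pushforward.
rewrite (_ : _ @^-1` _ = [set` `[a0, (a0 + l)%R]] `*` borel_cube a l); last first.
  apply/seteqP; split=> -[x y] /=; rewrite /borel_cube/= in_itv/=.
    move=> xya; split=> [|i]; first by have := xya ord0.
    by have := xya (lift ord0 i); rewrite !tnthS.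
  move=> [xa ya] i; case: (unliftP ord0 i) => [j ->|->]; last by rewrite !tnth0.
  by rewrite !tnthS.
rewrite product_measure1E//; last exact: measurable_borel_cube.
rewrite [X in _ * X]IH /= lebesgue_measure_itv/= lte_fin ltrDl l0 -EFinB.
by rewrite addrAC subrr add0r -EFinM exprS.
Qed.

Section Completion.
Variable d : nat.

(* R^d with its Lebesgue (complete) sigma-algebra *)
Definition Rd : Type := caratheodory_type ((borel_leb d)^*)%mu.

HB.instance Definition _ := Measurable.on Rd.

Definition leb : set Rd -> \bar R :=
  @completed_measure_extension _ _ _ (borel_leb d).

HB.instance Definition _ := Measure.on leb.

Let leb_sigma_finite : sigma_finite setT leb.
Proof.
exact/completed_measure_extension_sigma_finite/sigma_finiteT.
Qed.

HB.instance Definition _ :=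
  @Measure_isSigmaFinite.Build _ _ _ leb leb_sigma_finite.

End Completion.

End LebesgueMeasure.

Arguments Rd R d : clear implicits.
Arguments leb {R d} _.

Section GrowthFunctions.
Variable R : realType.
Implicit Types (Phi : R -> R) (q : R).

Local Open Scope ring_scope.

(* A function on R_+ is a function on R of which only the values on
   [0, +oo[ matter. *)
Definition Rplus : set R := [set` `[0, +oo[].

Definition growth Phi :=
  [/\ set_fun Rplus Rplus Phi, exists2 t, 0 <= t & Phi t != 0,
      {within Rplus, continuous Phi},
      {in Rplus &, {homo Phi : s t / s <= t}} & set_surj Rplus Rplus Phi].

(* inverse of a bijection of R_+ *)
Definition ginv Phi : R -> R := 'pinv_(fun=> 0) Rplus Phi.

Definition upper_type q Phi :=
  0 < q /\ exists2 C, 0 < C &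
    forall s t, 0 < s -> 1 <= t -> Phi (s * t) <= C * t `^ q * Phi s.

Definition Uq q Phi :=
  [/\ growth Phi, upper_type q Phi &
      {in `]0, +oo[ &, {homo (fun t => Phi t / t) : s t / s <= t}}].

(* The standing convention on the class U.  For Phi convex, nondecreasing and
   continuous at 0, class C^1 on ]0, +oo[ is the same as class C^1 on R_+. *)
Definition normalized Phi :=
  [/\ convex_function (Rplus : set R) Phi,
      (forall t, 0 < t -> derivable Phi t 1),
      {in `]0, +oo[, continuous (derive1 Phi)} &
      exists c1 c2, [/\ 0 < c1, 0 < c2 & forall t, 0 < t ->
        c1 * (Phi t / t) <= derive1 Phi t <= c2 * (Phi t / t)]].

Definition Delta' Phi :=
  exists2 C, 0 < C &
    forall s t, 0 < s -> 0 < t -> Phi (s * t) <= C * Phi s * Phi t.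

Definition Delta2 Phi :=
  exists2 K, 0 < K & forall t, 0 < t -> Phi (2 * t) <= K * Phi t.

Definition nabla2 Phi :=
  [/\ growth Phi, convex_function (Rplus : set R) Phi, Delta2 Phi &
      exists2 C, 0 < C & forall t : R, 0 < t ->
        (\int[lebesgue_measure]_(s in [set` `]0%R, t]]) (Phi s / s ^+ 2)%R%:E
           <= (C * (Phi t / t))%R%:E)%E].

Definition Uqtilde q Phi :=
  [/\ Uq q Phi, Delta' Phi &
      exists2 C, 0 < C &
        forall s t, 1 <= s -> 1 <= t -> Phi (s / t) <= C * Phi s / t `^ q].

Definition Utilde Phi := exists2 q, 1 <= q & Uqtilde q Phi.

End GrowthFunctions.

Arguments Rplus {R}.

Section Weights.
Variables (R : realType) (d : nat).
Local Notation Rd := (Rd R d).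
Implicit Types (w : Rd -> R) (Q : set Rd).

Definition cube (a : d.-tuple R) (l : R) : set Rd := borel_cube a l.

Definition cubes : set (set Rd) :=
  [set Q | exists a l, (0 < l)%R /\ Q = cube a l].

Lemma measurable_cube a l : measurable (cube a l).
Proof.
apply: sub_caratheodory; apply: sub_sigma_algebra.
exact: measurable_borel_cube.
Qed.

Lemma leb_cube a l : (0 < l)%R -> leb (cube a l) = (l ^+ d)%:E.
Proof.
move=> l0; rewrite -(borel_leb_cube a l0) /leb /completed_measure_extension.
apply: measurable_mu_extE; exact: measurable_borel_cube.
Qed.

Definition vol Q : R := fine (leb Q).

(* Local integrability is tested on cubes: every compact set lies in one. *)
Definition weight w :=
  [/\ measurable_fun setT w,
      forall Q, cubes Q -> leb.-integrable Q (EFin \o w) &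
      {ae leb, forall x, (0 < w x)%R}].

Definition mass w (E : set Rd) : \bar R := \int[leb]_(x in E) (w x)%:E.

Definition cmeasurable (f : Rd -> R[i]) :=
  measurable_fun setT (fun x => complex.Re (f x)) /\
  measurable_fun setT (fun x => complex.Im (f x)).

Definition cabs (z : R[i]) : R := ComplexField.Normc.normc z.

Definition multi_maximal n (alpha : R) (f : 'I_n -> Rd -> R[i]) (x : Rd)
    : \bar R :=
  ereal_sup [set (vol Q `^ (alpha / d%:R))%:E *
      \prod_(i < n) ((\1_Q x / vol Q)%:E * \int[leb]_(y in Q) (cabs (f i y))%:E)
    | Q in cubes].

Definition maximal (f : Rd -> R[i]) (x : Rd) : \bar R :=
  ereal_sup [set (\1_Q x / vol Q)%:E * \int[leb]_(y in Q) (cabs (f y))%:E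
    | Q in cubes].

Definition Ainfty_const w : \bar R :=
  ereal_sup [set (fine (mass w Q))^-1%:E *
      \int[leb]_(x in Q) maximal (fun y => (w y * \1_Q y)%:C) x
    | Q in cubes].

Definition Ainfty w := Ainfty_const w < +oo.

(* Luxemburg norm of an extended-real-valued function g; [er_map Phi] extends
   Phi by Phi(+oo) = +oo. *)
Definition lux (Phi : R -> R) w (g : Rd -> \bar R) : \bar R :=
  ereal_inf [set l%:E | l in [set l : R | (0 < l)%R /\
    \int[leb]_x (er_map Phi (`|g x| * l^-1%:E) * (w x)%:E) <= 1]].

Definition luxc (Phi : R -> R) w (f : Rd -> R[i]) : \bar R :=
  lux Phi w (fun x => (cabs (f x))%:E).

Definition LPhi (Phi : R -> R) w : set (Rd -> R[i]) :=
  [set f | cmeasurable f /\ luxc Phi w f < +oo].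

Definition A_const n (alpha : R) (Phis : 'I_n -> R -> R) (Psi : R -> R)
    (sigma : 'I_n -> Rd -> R) (omega : Rd -> R) : \bar R :=
  ereal_sup [set mass omega Q *
      (Psi (\prod_(i < n) (fine (mass (sigma i) Q) /
                           vol Q `^ (1 - alpha / (n * d)%:R)))%R)%:E *
      (Psi (\prod_(i < n) ginv (Phis i) (fine (mass (sigma i) Q))^-1)%R)%:E
    | Q in cubes].

End Weights.

(* Main.v *)
Require Import Defs.
From mathcomp Require Import all_boot all_order all_algebra.
From mathcomp Require Import all_classical all_reals all_analysis.
From mathcomp.real_closed Require Import complex.
From mathcomp Require Import measurable_realfun ring lra zify.

(** The class [Utilde] is much smaller than its definition suggests: its
    conditions force [Phi t] to be comparable with a power [t `^ p] on the whole
    half-line ([Utilde_power_like]). Hence the statement is a weighted inequality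
    between Lebesgue spaces, with exponents [p i] for [Phis i] and [r] for [Psi].
    The condition [nabla2] excludes [p i = 1] ([nabla2_gt1]), and the monotonicity
    of [Psi / Phis i] gives [p i <= r] ([power_like_le_exponent]).

    By the one-third trick ([cube_in_grid]) every cube lies in a comparable cube of
    one of finitely many shifted dyadic grids, so that Fatou's lemma reduces the
    maximal function to grids with finitely many scales ([maximal_estimate]). On one
    grid, follow the nested cells around a point from large to small and record the
    multilinear average whenever it exceeds a fixed multiple of the last recorded
    value. The maximal function is at most a multiple of the last record, whose
    [r]-th power is at most the sum of the [r]-th powers of all the records
    ([le_record], [record_powR_le]). Two facts control this sum.

    First, Jensen's inequality and the constant [A_const] bound the mass of one
    recorded cell [Q] by [A_const] times the [p]-th power of the average of a single
    function [f i0] over [Q], times the weight [sigma i0] of [Q]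
    ([testing_condition]): each of the other averages is at most a constant times
    [ginv (Phis i) (1 / sigma i Q)], and since [p <= r] the remaining one may be
    taken to the power [p] ([testing_algebra]).

    Secondly, the recorded cells form a Carleson family for [sigma i0]: within a
    recorded cell, the later ones cover at most half of it, by the weak-type
    inequality ([principal_half]), so that the sum of their [sigma i0]-masses is at
    most an integral of the maximal function of [sigma i0] restricted to the cell,
    which the A-infinity constant controls ([principal_carleson]). The Carleson
    embedding theorem, a summation by parts followed by Doob's maximal inequality,
    then bounds the sum by the integral of the [p]-th power of [f i0]
    ([carleson_embedding], [doob]).

    This yields the bound with the A-infinity constant of [sigma i0] alone. As all
    these constants are at least [1] ([Ainfty_const_ge1]), it is at most their
    product with exponents [q i >= 1]. *)

Set Implicit Arguments.
Unset Strict Implicit.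
Unset Printing Implicit Defensive.

Import Order.TTheory GRing.Theory Num.Theory.
Import numFieldNormedType.Exports.

Local Open Scope classical_set_scope.
Local Open Scope ring_scope.
Local Open Scope complex_scope.

(** * Real inequalities behind the maximal theorem *)

Lemma powR_predM (R : realType) (p m : R) : 0 < p -> 0 <= m ->
  m `^ (p - 1) * m = m `^ p.
Proof.
move=> p0; rewrite le_eqVlt => /predU1P[<-|m0].
  by rewrite mulr0 powR0// gt_eqF.
rewrite -{2}(powRr1 (ltW m0)) -powRD ?subrK//.
by rewrite gt_eqF// implybT.
Qed.

(** The convex function [t `^ p] lies above its tangent line at [m]. This form of
    Young's inequality serves for Jensen's inequality, for the pathwise form of
    Doob's inequality and for the absorption argument that concludes it. *)
Lemma powR_tangent (R : realType) (p x m : R) : 1 < p -> 0 <= x -> 0 <= m ->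
  p * m `^ (p - 1) * x <= x `^ p + (p - 1) * m `^ p.
Proof.
move=> p1 x0 m0; have p0 : 0 < p by lra.
have q0 : 0 < p - 1 by lra.
have := @conjugate_powR _ x (m `^ (p - 1)) p (p / (p - 1)) x0 (powR_ge0 _ _) p0.
rewrite divr_gt0// -powRrM => /(_ isT).
rewrite (_ : (p - 1) * (p / (p - 1)) = p); last by field; lra.
rewrite (_ : p^-1 + _ = 1); last by field; lra.
move=> /(_ erefl); rewrite -(ler_pM2l p0) -mulrA [m `^ _ * x]mulrC.
move=> /le_trans; apply.
by rewrite le_eqVlt; apply/orP; left; apply/eqP; field; lra.
Qed.

Lemma absorb_half (R : realType) (a b c : R) :
  a <= 2^-1 * a + c / 2 * b -> a <= c * b.
Proof. lra. Qed.

Lemma abel_sum (R : pzRingType) (c M : nat -> R) J : M 0%N = 0 ->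
  \sum_(i < J) (M i.+1 - M i) * (\sum_(i <= j < J) c j)
  = \sum_(j < J) M j.+1 * c j.
Proof.
move=> M0; elim: J => [|J IH]; first by rewrite !big_ord0.
rewrite [RHS]big_ord_recr/= -IH big_ord_recr/= big_nat1.
under eq_bigr => i _ do rewrite big_nat_recr 1?ltnW// mulrDr.
rewrite big_split/= -addrA; congr (_ + _).
rewrite -mulr_suml -mulrDl; congr (_ * _).
rewrite -(big_mkord xpredT (fun i => M i.+1 - M i)) telescope_sumr// M0 subr0.
by rewrite addrC subrK.
Qed.

(** * Integrals of nonnegative real functions *)

Section NonnegativeFunctions.
Context d0 (T : measurableType d0) (R : realType).
Implicit Types (f g : T -> R) (D : set T).

Definition nnm f := measurable_fun setT f /\ forall x, 0 <= f x.

Lemma nnm_cst (k : R) : 0 <= k -> nnm (fun=> k).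
Proof. by []. Qed.

Lemma nnmM f g : nnm f -> nnm g -> nnm (fun x => f x * g x).
Proof.
move=> [mf f0] [mg g0]; split=> [|x]; first exact: measurable_funM.
by rewrite mulr_ge0.
Qed.

Lemma nnmD f g : nnm f -> nnm g -> nnm (fun x => f x + g x).
Proof.
move=> [mf f0] [mg g0]; split=> [|x]; first exact: measurable_funD.
by rewrite addr_ge0.
Qed.

Lemma nnm_powR (p : R) f : nnm f -> nnm (fun x => f x `^ p).
Proof.
move=> [mf f0]; split=> [|x]; last exact: powR_ge0.
exact: measurableT_comp (measurable_powR p) mf.
Qed.

Lemma nnm_sum (J : Type) (r : seq J) (P : pred J) (F : J -> T -> R) :
  (forall j, nnm (F j)) -> nnm (fun x => \sum_(j <- r | P j) F j x).
Proof.
move=> FF; split=> [|x]; last by apply: sumr_ge0 => j _; have [] := FF j.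
under eq_fun do rewrite big_mkcond.
apply: measurable_sum => j; case: (P j) => //; by have [] := FF j.
Qed.

Variable mu : {measure set T -> \bar R}.

Lemma integral_nnm_ge0 D f : nnm f -> (0 <= \int[mu]_(x in D) (f x)%:E)%E.
Proof. by move=> [_ f0]; apply: integral_ge0 => x _; rewrite lee_fin. Qed.

Lemma le_integral_nnm D f g : measurable D -> nnm f -> nnm g ->
  (forall x, D x -> f x <= g x) ->
  (\int[mu]_(x in D) (f x)%:E <= \int[mu]_(x in D) (g x)%:E)%E.
Proof.
move=> mD [mf f0] [mg g0] fg; apply: ge0_le_integral => //.
- by move=> x _; rewrite lee_fin.
- by apply: measurable_funTS; apply/measurable_EFinP.
- by apply: measurable_funTS; apply/measurable_EFinP.
Qed.

Lemma subset_integral_nnm A B f : measurable A -> measurable B -> nnm f ->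
  A `<=` B ->
  (\int[mu]_(x in A) (f x)%:E <= \int[mu]_(x in B) (f x)%:E)%E.
Proof.
move=> mA mB [mf f0] AB.
apply: ge0_subset_integral; [exact: mA|exact: mB| | |exact: AB].
- by apply: measurable_funTS; apply/measurable_EFinP.
- by move=> x _; rewrite lee_fin.
Qed.

Lemma integral_nnmZ D k f : measurable D -> 0 <= k -> nnm f ->
  (\int[mu]_(x in D) (k * f x)%:E = k%:E * \int[mu]_(x in D) (f x)%:E)%E.
Proof.
move=> mD k0 [mf f0]; rewrite -ge0_integralZl_EFin//.
- by move=> x _; rewrite lee_fin.
- by apply: measurable_funTS; apply/measurable_EFinP.
Qed.

Lemma integral_nnmD D f g : measurable D -> nnm f -> nnm g ->
  (\int[mu]_(x in D) (f x + g x)%:E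
   = \int[mu]_(x in D) (f x)%:E + \int[mu]_(x in D) (g x)%:E)%E.
Proof.
move=> mD [mf f0] [mg g0]; rewrite -ge0_integralD//.
- by move=> x _; rewrite lee_fin.
- by apply: measurable_funTS; apply/measurable_EFinP.
- by move=> x _; rewrite lee_fin.
- by apply: measurable_funTS; apply/measurable_EFinP.
Qed.

Lemma integral_nnm_sum D (J : Type) (r : seq J) (F : J -> T -> R) :
  measurable D -> (forall j, nnm (F j)) ->
  (\int[mu]_(x in D) (\sum_(j <- r) F j x)%R%:E
   = \sum_(j <- r) \int[mu]_(x in D) (F j x)%:E)%E.
Proof.
move=> mD FF; rewrite -ge0_integral_sum//.
- by apply: eq_integral => x _; rewrite sumEFin.
- by move=> j; apply: measurable_funTS; apply/measurable_EFinP; have [] := FF j.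
- by move=> j x _; rewrite lee_fin; have [] := FF j.
Qed.

End NonnegativeFunctions.

#[local] Hint Resolve nnm_cst nnmM nnmD nnm_powR nnm_sum : nnm.
#[local] Hint Extern 0 (is_true (0 <= _)) => lra : nnm.

Local Ltac nnm := solve [auto 12 with nnm | done].

(** Jensen's inequality for powers, from the tangent line at the average. *)
Lemma jensen_powR d0 (T : measurableType d0) (R : realType)
    (mu : {measure set T -> \bar R}) (D : set T) (g s : T -> R) (p : R) :
  measurable D -> nnm g -> nnm s -> 1 < p ->
  (0 < \int[mu]_(y in D) (s y)%:E < +oo)%E ->
  (\int[mu]_(y in D) (g y * s y)%:E < +oo)%E ->
  (((fine (\int[mu]_(y in D) (g y * s y)%:E)
     / fine (\int[mu]_(y in D) (s y)%:E)) `^ p)%:E * \int[mu]_(y in D) (s y)%:E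
  <= \int[mu]_(y in D) (g y `^ p * s y)%:E)%E.
Proof.
move=> mD gg ss p1 /andP[S0 Sy] Gy.
have Sf : (\int[mu]_(y in D) (s y)%:E)%E \is a fin_num by rewrite ge0_fin_numE// ltW.
have Gf : (\int[mu]_(y in D) (g y * s y)%:E)%E \is a fin_num.
  by rewrite ge0_fin_numE; [exact: Gy|apply: integral_nnm_ge0; nnm].
have G0 : 0 <= fine (\int[mu]_(y in D) (g y * s y)%:E).
  by rewrite fine_ge0// integral_nnm_ge0//; nnm.
have SS : 0 < fine (\int[mu]_(y in D) (s y)%:E) by rewrite fine_gt0// S0.
move: (fineK Sf) (fineK Gf) SS G0.
move: (fine (\int[mu]_(y in D) (s y)%:E)) (fine (\int[mu]_(y in D) (g y * s y)%:E)).
move=> S G SE GE SS G0; set m := G / S; have m0 : 0 <= m by rewrite divr_ge0// ltW.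
have mS : m * S = G by rewrite /m mulfVK// gt_eqF.
have mp0 := powR_ge0 m p; have mp1 := powR_ge0 m (p - 1).
have k0 : 0 <= p * m `^ (p - 1) by rewrite mulr_ge0//; lra.
have k1 : 0 <= (p - 1) * m `^ p by rewrite mulr_ge0//; lra.
have : (\int[mu]_(y in D) (p * m `^ (p - 1) * (g y * s y))%:E
    <= \int[mu]_(y in D) (g y `^ p * s y + (p - 1) * m `^ p * s y)%:E)%E.
  apply: le_integral_nnm; [exact: mD|nnm|nnm|move=> y _].
  rewrite mulrA -mulrDl ler_wpM2r//; first by have [] := ss.
  by apply: powR_tangent => //; have [] := gg.
rewrite integral_nnmD; [|exact: mD|nnm|nnm].
rewrite !integral_nnmZ; [|exact: mD|exact: k1|exact: ss|exact: mD|exact: k0|nnm].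
rewrite -SE -GE; case: (integral _ _ _) => [P| |]//; last by move=> _; rewrite leey.
rewrite -!EFinM -EFinD !lee_fin -mS.
have -> : p * m `^ (p - 1) * (m * S) = p * m `^ p * S.
  by rewrite mulrA -(mulrA p) powR_predM//; lra.
by rewrite -subr_ge0 => h; rewrite -subr_ge0; apply: le_trans h _; lra.
Qed.

(** * Nested countable partitions of a measure space *)

Section NestedPartitions.
Context d0 (T : measurableType d0) (R : realType).
Variable mu : {measure set T -> \bar R}.
Context (I : countType) (idx : nat -> T -> I).
Hypothesis midx : forall j k, measurable [set x | idx j x = k].
Hypothesis nest : forall j x y, idx j.+1 x = idx j.+1 y -> idx j x = idx j y.

Definition cell j x : set T := [set y | idx j y = idx j x].

(** Measurability with respect to the partition of index [j]. *)
Definition level U j (h : T -> U) := forall x y, idx j x = idx j y -> h x = h y.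

Lemma measurable_cell j x : measurable (cell j x). Proof. exact: midx. Qed.

Lemma idx_le i j x y : (i <= j)%N -> idx j x = idx j y -> idx i x = idx i y.
Proof.
move=> /subnK <-; elim: (j - i)%N => // k IH e; apply: IH; exact: nest.
Qed.

Lemma level_le U i j (h : T -> U) : (i <= j)%N -> level i h -> level j h.
Proof. by move=> ij hi x y /(idx_le ij) /hi. Qed.

Lemma level_measurable d1 (U : measurableType d1) j (h : T -> U) :
  level j h -> measurable_fun [set: T] h.
Proof.
move=> hj _ B mB; rewrite setTI.
rewrite (_ : h @^-1` B = \bigcup_n [set x | pickle (idx j x) = n /\ B (h x)]).
  apply: bigcupT_measurable => n.
  have [[x [xn Bx]]|hn] := pselect (exists x, pickle (idx j x) = n /\ B (h x)).
    rewrite (_ : mkset _ = cell j x); first exact: measurable_cell.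
    apply/seteqP; split=> y /=.
      by move=> [yn _]; apply: (pcan_inj pickleK); rewrite yn xn.
    by move=> yx; rewrite yx (hj _ _ yx).
  rewrite (_ : mkset _ = set0)//; apply/seteqP; split=> // x hx; case: hn.
  by exists x.
by apply/seteqP; split=> x /= => [Bx|[n _ []]//]; exists (pickle (idx j x)).
Qed.

Lemma level_nnm j (h : T -> R) : level j h -> (forall x, 0 <= h x) -> nnm h.
Proof. by move=> hj h0; split=> //; exact: level_measurable hj. Qed.

Lemma integral_levelM j x (h g : T -> R) :
  level j h -> (forall x, 0 <= h x) -> nnm g ->
  (\int[mu]_(y in cell j x) (h y * g y)%:E
  = (h x)%:E * \int[mu]_(y in cell j x) (g y)%:E)%E.
Proof.
move=> hj h0 gg; rewrite -integral_nnmZ//; last exact: measurable_cell.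
by apply: eq_integral => y; rewrite inE => yx; rewrite (hj _ _ yx).
Qed.

(** A function that is constant on cells pulls out of the integral over each
    cell; this replaces conditional expectations everywhere below. *)
Lemma le_integral_cells j (D : set T) (h g1 g2 : T -> R) :
  (forall x y, idx j x = idx j y -> D x -> D y) ->
  level j h -> (forall x, 0 <= h x) -> nnm g1 -> nnm g2 ->
  (forall x, D x -> 0 < h x ->
    (\int[mu]_(y in cell j x) (g1 y)%:E <= \int[mu]_(y in cell j x) (g2 y)%:E)%E) ->
  (\int[mu]_(x in D) (h x * g1 x)%:E <= \int[mu]_(x in D) (h x * g2 x)%:E)%E.
Proof.
move=> Dj hj h0 gg1 gg2 g12.
pose F n : set T := [set x | pickle (idx j x) = n /\ D x].
have Fcell n x : F n x -> F n = cell j x.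
  move=> [xn Dx]; apply/seteqP; split=> y /=.
    by move=> [yn _]; apply: (pcan_inj pickleK); rewrite yn xn.
  by move=> yx; rewrite /F /= yx; split=> //; apply: (Dj x).
have mF n : measurable (F n).
  have [[x Fx]|Fn] := pselect (exists x, F n x).
    by rewrite (Fcell _ _ Fx); exact: measurable_cell.
  rewrite (_ : F n = set0)//; apply/seteqP; split=> // x Fx; case: Fn.
  by exists x.
have DE : D = \bigcup_n F n.
  by apply/seteqP; split=> x => [Dx|[n _ []]//]; exists (pickle (idx j x)).
have hh : nnm h by exact: level_nnm hj h0.
have tF : trivIset setT F by move=> m n _ _ [x [[<- _] [<- _]]].
have split_cells g : nnm g -> (\int[mu]_(x in D) (h x * g x)%:E
    = \sum_(n <oo) \int[mu]_(x in F n) (h x * g x)%:E)%E.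
  move=> gg; have [mhg hg0] := nnmM hh gg.
  rewrite [in LHS]DE ge0_integral_bigcup// -?DE.
    by apply: (@measurable_funTS _ _ _ _ D); apply/measurable_EFinP.
  by move=> x _; rewrite lee_fin.
rewrite !split_cells//; apply: lee_nneseries => [n _ _|n _].
  by apply: integral_nnm_ge0; nnm.
have [[x Fx]|Fn] := pselect (exists x, F n x); last first.
  rewrite (_ : F n = set0) ?integral_set0//; apply/seteqP; split=> // x Fx.
  by case: Fn; exists x.
rewrite (Fcell _ _ Fx) !integral_levelM//.
have := h0 x; rewrite le_eqVlt => /predU1P[<-|hx]; first by rewrite !mul0e.
by rewrite lee_pmul2l ?lte_fin// g12//; case: Fx.
Qed.

Lemma le_integral_cells1 j (D : set T) (g1 g2 : T -> R) :
  (forall x y, idx j x = idx j y -> D x -> D y) -> nnm g1 -> nnm g2 ->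
  (forall x, D x ->
    (\int[mu]_(y in cell j x) (g1 y)%:E <= \int[mu]_(y in cell j x) (g2 y)%:E)%E) ->
  (\int[mu]_(x in D) (g1 x)%:E <= \int[mu]_(x in D) (g2 x)%:E)%E.
Proof.
move=> Dj gg1 gg2 g12.
have E (g : T -> R) :
    (\int[mu]_(x in D) (g x)%:E = \int[mu]_(x in D) (1 * g x)%:E)%E.
  by apply: eq_integral => x _; rewrite mul1r.
by rewrite E [leRHS]E; apply: (@le_integral_cells j) => // x Dx _; exact: g12.
Qed.

(** * Averages and maximal functions *)

Section Averages.
Variable s : T -> R.
Hypothesis ss : nnm s.
Hypothesis scell : forall j x, (0 < \int[mu]_(y in cell j x) (s y)%:E < +oo)%E.

Definition avg (g : T -> R) j x : R :=
  fine (\int[mu]_(y in cell j x) (g y * s y)%:E)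
  / fine (\int[mu]_(y in cell j x) (s y)%:E).

Lemma level_avg g j : level j (avg g j).
Proof. by move=> x y xy; rewrite /avg /cell xy. Qed.

Lemma scell_fin j x : (\int[mu]_(y in cell j x) (s y)%:E)%E \is a fin_num.
Proof. by have /andP[sx sy] := scell j x; rewrite ge0_fin_numE// ltW. Qed.

Section OneFunction.
Variable g : T -> R.
Hypothesis gg : nnm g.
Hypothesis gcell :
  forall j x, (\int[mu]_(y in cell j x) (g y * s y)%:E < +oo)%E.

Lemma avg_ge0 j x : 0 <= avg g j x.
Proof. by rewrite /avg divr_ge0 ?fine_ge0// integral_nnm_ge0//; nnm. Qed.

Lemma nnm_avg j : nnm (avg g j).
Proof. exact: level_nnm (@level_avg g j) (avg_ge0 j). Qed.

Lemma avgE j x : ((avg g j x)%:E * \int[mu]_(y in cell j x) (s y)%:E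
  = \int[mu]_(y in cell j x) (g y * s y)%:E)%E.
Proof.
have /andP[sx sy] := scell j x.
rewrite /avg -[in X in (_ * X)%E](fineK (scell_fin j x)) -EFinM mulfVK ?fineK//.
  by rewrite ge0_fin_numE ?gcell// integral_nnm_ge0//; nnm.
by rewrite gt_eqF// fine_gt0// sx.
Qed.

Lemma avg_powR_le (p : R) j x : 1 < p ->
  ((avg g j x `^ p)%:E * \int[mu]_(y in cell j x) (s y)%:E
  <= \int[mu]_(y in cell j x) (g y `^ p * s y)%:E)%E.
Proof.
by move=> p1; apply: jensen_powR => //; exact: measurable_cell.
Qed.

Fixpoint maxavg J x :=
  if J is J'.+1 then Num.max (maxavg J' x) (avg g J' x) else 0.

Lemma maxavgS J x : maxavg J.+1 x = Num.max (maxavg J x) (avg g J x).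
Proof. by []. Qed.

Lemma maxavg_ge0 J x : 0 <= maxavg J x.
Proof. by elim: J => //= J IH; rewrite le_max IH. Qed.

Lemma level_maxavg J : level J (maxavg J.+1).
Proof.
elim: J => [|J IH] x y xy; first by rewrite !maxavgS (level_avg g xy).
rewrite maxavgS [in RHS]maxavgS (level_avg g xy); congr (Num.max _ _).
exact: level_le (leqnSn J) IH x y xy.
Qed.

Lemma level_maxavgW J : level J (maxavg J).
Proof.
case: J => [//|J].
exact: level_le (leqnSn J) (@level_maxavg J).
Qed.

(** The pathwise form of Doob's inequality: the maximum increases at step [i] only
    if it becomes equal to the average at that level, and convexity bounds the
    increment of its [p]-th power. *)
Lemma maxavg_pathwise (p : R) J x : 1 < p ->
  maxavg J x `^ p <= \sum_(i < J)
    (p / (p - 1)) * (maxavg i.+1 x `^ (p - 1) - maxavg i x `^ (p - 1)) * avg g i x.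
Proof.
move=> p1; elim: J => [|J IH].
  by rewrite big_ord0 powR0//; apply/eqP; lra.
rewrite big_ord_recr/= -lerBlDr; apply: le_trans IH.
rewrite lerBlDr -lerBlDl.
have c0 := maxavg_ge0 J x; have b0 := avg_ge0 J x; move: c0 b0.
move: (maxavg J x) (avg g J x) => c b c0 b0.
have [bc|cb] := leP b c; first by rewrite !subrr mulr0 mul0r.
have h := powR_tangent p1 b0 c0.
rewrite -mulrA mulrBl (powR_predM _ b0); last by lra.
rewrite -(ler_pM2l (_ : 0 < p - 1)) ?subr_gt0//.
apply: le_trans (_ : p * b `^ p - p * c `^ (p - 1) * b <= _); first by lra.
by rewrite le_eqVlt; apply/orP; left; apply/eqP; field; lra.
Qed.

Lemma nnm_maxavg J : nnm (maxavg J).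
Proof. exact: level_nnm (@level_maxavgW J) (maxavg_ge0 J). Qed.

Lemma integral_avg_powR_le p j : 1 < p ->
  (\int[mu]_x (avg g j x `^ p * s x)%:E <= \int[mu]_x (g x `^ p * s x)%:E)%E.
Proof.
move=> p1; have aa := nnm_avg j.
apply: (@le_integral_cells1 j); [by []|nnm|nnm|move=> x _].
rewrite integral_levelM; [exact: avg_powR_le| | |exact: ss].
- by move=> y z yz; rewrite (level_avg g yz).
- by move=> y; exact: powR_ge0.
Qed.

Lemma integral_maxavg_fin p J : 1 < p ->
  (\int[mu]_x (g x `^ p * s x)%:E < +oo)%E ->
  (\int[mu]_x (maxavg J x `^ p * s x)%:E < +oo)%E.
Proof.
move=> p1 gp; elim: J => [|J IH].
  rewrite integral0_eq// => x _; rewrite /= powR0 ?mul0r//.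
  by apply/eqP; lra.
have aa := nnm_avg J; have MM := nnm_maxavg J; have MM' := nnm_maxavg J.+1.
apply: (@le_lt_trans _ _
  (\int[mu]_x (maxavg J x `^ p * s x + avg g J x `^ p * s x)%:E)%E).
  apply: le_integral_nnm => //; [nnm|nnm|move=> x _].
  rewrite -mulrDl ler_wpM2r//; first by have [] := ss.
  rewrite maxavgS; case: (leP (maxavg J x)) => _; [rewrite lerDr|rewrite lerDl];
    exact: powR_ge0.
rewrite integral_nnmD//; [|nnm|nnm].
apply: lte_add_pinfty; first exact: IH.
exact: le_lt_trans (integral_avg_powR_le J p1) gp.
Qed.

(** Doob's maximal inequality. Summing the pathwise bound, each average may be
    replaced by the function itself; Young's inequality then absorbs half of the
    left-hand side, which is finite. *)
Lemma doob p J : 1 < p -> (\int[mu]_x (g x `^ p * s x)%:E < +oo)%E ->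
  (\int[mu]_x (maxavg J x `^ p * s x)%:E
   <= (2 `^ p / (p - 1))%:E * \int[mu]_x (g x `^ p * s x)%:E)%E.
Proof.
move=> p1 gp; have MM := nnm_maxavg J; have Mfin := integral_maxavg_fin J p1 gp.
have p0 : 0 < p - 1 by lra.
pose w i x := (p / (p - 1)) * (maxavg i.+1 x `^ (p - 1) - maxavg i x `^ (p - 1)).
have w0 i x : 0 <= w i x.
  rewrite /w mulr_ge0 ?divr_ge0//; [lra|exact: ltW|].
  rewrite subr_ge0 ge0_ler_powR ?nnegrE ?maxavg_ge0//; first exact: ltW.
  by rewrite /= le_max lexx.
have wl i : level i (w i).
  by move=> x y xy; rewrite /w (level_maxavg xy) (level_maxavgW xy).
have ww i : nnm (w i) by exact: level_nnm (wl i) (w0 i).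
have aa i := nnm_avg i.
set c := (2 `^ p / (p - 1)); have c0 : 0 <= c by rewrite divr_ge0 ?powR_ge0// ltW.
have : (\int[mu]_x (maxavg J x `^ p * s x)%:E <=
    \int[mu]_x (2^-1 * (maxavg J x `^ p * s x)
                + (c / 2) * (g x `^ p * s x))%:E)%E.
  apply: (@le_trans _ _
      (\int[mu]_x (\sum_(i < J) w i x * (avg g i x * s x))%:E)%E).
    apply: le_integral_nnm => //; [nnm|nnm|move=> x _].
    under eq_bigr do rewrite mulrA; rewrite -mulr_suml.
    by rewrite ler_wpM2r//; [have [] := ss|exact: maxavg_pathwise].
  apply: (@le_trans _ _ (\int[mu]_x (\sum_(i < J) w i x * (g x * s x))%:E)%E).
    rewrite !integral_nnm_sum//; [|move=> i; nnm|move=> i; nnm].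
    apply: lee_sum => i _; apply: (@le_integral_cells i) => //; [nnm|nnm|].
    move=> x _ _; rewrite integral_levelM ?avgE//; [exact: level_avg|].
    exact: avg_ge0.
  apply: le_integral_nnm => //; [nnm|nnm|move=> x _].
  have s0 : 0 <= s x by have [] := ss.
  have g0 : 0 <= g x by have [] := gg.
  have m0 := maxavg_ge0 J x.
  rewrite -mulr_suml -mulr_sumr.
  rewrite -(big_mkord xpredT (fun i => maxavg i.+1 x `^ (p - 1) - maxavg i x `^ (p - 1))).
  rewrite (telescope_sumr (fun i => maxavg i x `^ (p - 1)))//.
  rewrite [maxavg 0 x `^ _]powR0 ?subr0; last by apply/eqP; lra.
  rewrite mulrA !mulrA -mulrDl ler_wpM2r//.
  have := @powR_tangent _ p (2 * g x) _ p1 (mulr_ge0 (ler0n R 2) g0) m0.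
  rewrite powRM// => h; have k0 : 0 < (2 * (p - 1))^-1 by rewrite invr_gt0; lra.
  rewrite -(ler_pM2l k0) in h.
  rewrite (_ : p / (p - 1) * _ * _ =
      (2 * (p - 1))^-1 * (p * maxavg J x `^ (p - 1) * (2 * g x))); last first.
    by field; lra.
  apply: le_trans h _; rewrite le_eqVlt; apply/orP; left; apply/eqP.
  by rewrite /c; field; lra.
rewrite integral_nnmD//; [|nnm|nnm].
rewrite !integral_nnmZ; [|by []|by rewrite divr_ge0|nnm|by []|by rewrite invr_ge0|nnm].
have Gf : (\int[mu]_x (g x `^ p * s x)%:E)%E \is a fin_num.
  by rewrite ge0_fin_numE; [exact: gp|apply: integral_nnm_ge0; nnm].
have Mf : (\int[mu]_x (maxavg J x `^ p * s x)%:E)%E \is a fin_num.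
  by rewrite ge0_fin_numE; [exact: Mfin|apply: integral_nnm_ge0; nnm].
rewrite -(fineK Gf) -(fineK Mf) -!EFinM -EFinD !lee_fin.
exact: absorb_half.
Qed.

Definition exceeds i J (lam : R) x : bool :=
  [exists j : 'I_J, (i <= j)%N && (lam < avg g j x)].

Lemma level_exceeds i J lam : level J (exceeds i J lam).
Proof.
move=> x y xy; apply: eq_existsb => j.
by rewrite (level_avg g (idx_le (ltnW (ltn_ord j)) xy)).
Qed.

(** The weak-type maximal inequality, by downward induction on the level [i]: a
    cell whose average exceeds [lam] is paid for by that average, and on any other
    cell the condition only concerns the levels above [i]. *)
Lemma weak_type i J lam x : 0 < lam -> (i <= J)%N ->
  (\int[mu]_(y in cell i x) ((exceeds i J lam y)%:R * s y)%:E
   <= lam^-1%:E * \int[mu]_(y in cell i x) (g y * s y)%:E)%E.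
Proof.
move=> lam0 /subnK; move: (J - i)%N => n; rewrite addnC => <-.
have il0 : 0 <= lam^-1 by rewrite invr_ge0 ltW.
have ee i' J' : nnm (fun y => (exceeds i' J' lam y)%:R : R).
  apply: (@level_nnm J') => // y z yz; by rewrite (level_exceeds _ _ yz).
elim: n i x => [|n IH] i x; have mc := measurable_cell i x.
  rewrite -integral_nnmZ//; [|nnm].
  apply: le_integral_nnm => //; [nnm|nnm|move=> y _].
  rewrite (_ : exceeds _ _ _ _ = false) ?mul0r.
    by rewrite !mulr_ge0//; [have [] := gg|have [] := ss].
  by apply/existsP => -[[j /= jJ] /andP[]]; rewrite addn0 in jJ; rewrite leqNgt jJ.
have [lt_avg|le_avg] := ltP lam (avg g i x).
  rewrite -avgE muleA -EFinM; apply: (@le_trans _ _ (\int[mu]_(y in cell i x) (s y)%:E)%E).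
    apply: le_integral_nnm => //; [nnm|move=> y _].
    by case: exceeds; rewrite ?mul1r// mul0r; have [] := ss.
  rewrite lee_pemull//; first exact: integral_nnm_ge0.
  by rewrite lee_fin mulrC ler_pdivlMr// mul1r ltW.
rewrite -integral_nnmZ//; [|nnm].
rewrite (_ : integral _ _ _ = \int[mu]_(y in cell i x)
   ((exceeds i.+1 (i.+1 + n) lam y)%:R * s y)%:E)%E; last first.
  apply: eq_integral => y; rewrite inE => yx; congr (_%:R * _)%:E.
  rewrite addSnnS; congr nat_of_bool.
  apply/existsP/existsP => -[j /andP[ij aj]]; exists j; rewrite aj andbT.
    rewrite ltn_neqAle ij andbT; apply/eqP => e; move: aj.
    by rewrite -e (level_avg g yx) ltNge le_avg.
  exact: ltnW.
apply: (@le_integral_cells1 i.+1); [|nnm|nnm|].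
  by move=> y z /nest yz /= yx; rewrite /cell /= -yz.
move=> y _; rewrite [leRHS]integral_nnmZ; [|exact: measurable_cell|by []|nnm].
exact: IH.
Qed.

(** The Carleson embedding theorem. Writing the [p]-th power of the maximal
    average at level [j] as a telescoping sum and summing by parts, each
    increment is constant on cells, so that it meets the Carleson condition on
    one cell; what remains telescopes to the maximal function. *)
Lemma carleson_embedding (sel : nat -> T -> bool) (K p : R) J :
  (forall j, level j (sel j)) -> 0 <= K -> 1 < p ->
  (forall i x, (i < J)%N ->
    (\int[mu]_(y in cell i x) ((\sum_(i <= j < J) (sel j y)%:R) * s y)%:E
     <= K%:E * \int[mu]_(y in cell i x) (s y)%:E)%E) ->
  (\int[mu]_x (g x `^ p * s x)%:E < +oo)%E ->
  (\int[mu]_x (\sum_(j < J) (sel j x)%:R * (avg g j x `^ p * s x))%:E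
   <= (K * (2 `^ p / (p - 1)))%:E * \int[mu]_x (g x `^ p * s x)%:E)%E.
Proof.
move=> lsel K0 p1 carl gp.
have selsel j : nnm (fun x => (sel j x)%:R : R).
  by apply: (@level_nnm j) => // x y /lsel ->.
have aa j := nnm_avg j; have MM j := nnm_maxavg j.
pose w i x : R := maxavg i.+1 x `^ p - maxavg i x `^ p.
have w0 i x : 0 <= w i x.
  rewrite /w subr_ge0 ge0_ler_powR ?nnegrE ?maxavg_ge0//; first by lra.
  by rewrite /= le_max lexx.
have wl i : level i (w i).
  by move=> x y xy; rewrite /w (level_maxavg xy) (level_maxavgW xy).
have ww i : nnm (w i) by exact: level_nnm (wl i) (w0 i).
have s0 x : 0 <= s x by have [] := ss.
have M00 x : maxavg 0 x `^ p = 0 by rewrite /= powR0//; apply/eqP; lra.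
apply: (@le_trans _ _ (\int[mu]_x (\sum_(i < J) w i x *
    ((\sum_(i <= j < J) (sel j x)%:R) * s x))%:E)%E).
  apply: le_integral_nnm => //; [nnm|nnm|move=> x _].
  under [leRHS]eq_bigr do rewrite mulrA; rewrite -mulr_suml.
  have A := @abel_sum _ (fun j => (sel j x)%:R : R) (fun i => maxavg i x `^ p) J (M00 x).
  rewrite /w A mulr_suml.
  apply: ler_sum => j _; rewrite mulrA ler_wpM2r// mulrC ler_wpM2r//.
  by rewrite ge0_ler_powR ?nnegrE ?maxavg_ge0 ?avg_ge0//; [lra|rewrite /= le_max lexx orbT].
apply: (@le_trans _ _ (\int[mu]_x (\sum_(i < J) w i x * (K * s x))%:E)%E).
  rewrite !integral_nnm_sum//; [|move=> i; nnm|move=> i; nnm].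
  apply: lee_sum => i _; apply: (@le_integral_cells i) => //; [nnm|nnm|].
  move=> x _ _; rewrite [leRHS]integral_nnmZ; [|exact: measurable_cell|by []|by []].
  exact: carl.
apply: (@le_trans _ _ (\int[mu]_x (K * (maxavg J x `^ p * s x))%:E)%E).
  apply: le_integral_nnm => //; [nnm|nnm|move=> x _].
  rewrite -mulr_suml -(big_mkord xpredT (fun i => w i x)).
  by rewrite (telescope_sumr (fun i => maxavg i x `^ p))// M00 subr0 mulrCA.
rewrite integral_nnmZ; [|by []|by []|nnm].
by rewrite EFinM -muleA lee_wpmul2l ?lee_fin//; exact: doob.
Qed.

End OneFunction.
End Averages.

(** * Principal cells *)

Section PrincipalCells.
Variables (v : nat -> T -> R) (a : R).
Hypothesis v0 : forall j x, 0 <= v j x.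
Hypothesis lv : forall j, level j (v j).
Hypothesis a1 : 1 <= a.

(** A pointwise version of the selection of principal cubes: no choice of cubes
    is made, and every function in sight is constant on cells. *)
Fixpoint record j x :=
  if j is k.+1 then if a * record k x < v k x then v k x else record k x else 0.

Definition principal j x := a * record j x < v j x.

Lemma record_ge0 j x : 0 <= record j x.
Proof. by elim: j => //= j IH; case: ifP. Qed.

Lemma level_record j : level j (record j.+1).
Proof.
elim: j => [|j IH] x y xy; first by rewrite /= (lv xy).
have IH' : record j.+1 x = record j.+1 y by exact: level_le (leqnSn j) IH x y xy.
by rewrite /= -/(record j.+1 x) -/(record j.+1 y) IH' (lv xy).
Qed.

Lemma level_recordW j : level j (record j).
Proof.
by case: j => [//|j]; exact: level_le (leqnSn j) (@level_record j).
Qed.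

Lemma level_principal j : level j (principal j).
Proof. by move=> x y xy; rewrite /principal (level_recordW xy) (lv xy). Qed.

Lemma record_le i j x : (i <= j)%N -> record i x <= record j x.
Proof.
move=> /subnK <-; elim: (j - i)%N => // k IH; apply: le_trans IH _.
rewrite addSn /=; case: ifPn => // /ltW; apply: le_trans.
by rewrite ler_peMl// record_ge0.
Qed.

Lemma le_record j J x : (j < J)%N -> v j x <= a * record J x.
Proof.
move=> jJ; have a0 : 0 <= a by exact: le_trans a1.
apply: (@le_trans _ _ (a * record j.+1 x)); last first.
  by rewrite ler_wpM2l// record_le.
by rewrite /=; case: ifPn => [_|]; [rewrite ler_peMl|rewrite -leNgt].
Qed.

Lemma record_powR_le (r : R) J x : 0 < r ->
  record J x `^ r <= \sum_(j < J) (principal j x)%:R * v j x `^ r.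
Proof.
move=> r0; elim: J => [|J IH].
  by rewrite big_ord0 powR0// gt_eqF.
rewrite big_ord_recr/= /principal; case: ifPn => _; rewrite ?mul1r ?mul0r ?addr0//.
by rewrite lerDr; apply: sumr_ge0 => j _; rewrite mulr_ge0// powR_ge0.
Qed.

Variables (n : nat) (g : 'I_n -> T -> R) (s : T -> R) (K : R).
Hypothesis n0 : (0 < n)%N.
Let one : T -> R := fun=> 1.
Hypothesis one_cell : forall j x,
  (0 < \int[mu]_(y in cell j x) (one y)%:E < +oo)%E.
Hypothesis gg : forall i, nnm (g i).
Hypothesis gcell : forall i j x,
  (\int[mu]_(y in cell j x) (g i y * one y)%:E < +oo)%E.
(* The function [v] stands for the product of the averages of the [g i], scaled by
   a nonnegative power of the measure of the cell. *)
Hypothesis v_jump : forall j k x, (j <= k)%N ->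
  (forall i, avg one (g i) k x <= (2 * n)%:R * avg one (g i) j x) ->
  v k x <= a * v j x.
Hypothesis v_gt0 : forall i j x, 0 < v j x -> 0 < avg one (g i) j x.

Definition last_principal J j x :=
  principal j x && ~~ [exists k : 'I_J, (j < k)%N && principal k x].

Lemma level_last_principal J j : (j < J)%N -> level J (last_principal J j).
Proof.
move=> jJ x y xy; rewrite /last_principal (level_principal (idx_le (ltnW jJ) xy)).
congr (_ && ~~ _); apply: eq_existsb => k.
by rewrite (level_principal (idx_le (ltnW (ltn_ord k)) xy)).
Qed.

Lemma nnm_one : nnm one. Proof. exact: nnm_cst. Qed.

(** At a later principal level some average [avg one (g i)] has grown by the
    factor [2 * n]; by the weak-type inequality, this happens on at most half of
    the cell. *)
Lemma principal_half J j x : (j < J)%N -> principal j x ->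
  (\int[mu]_(y in cell j x) (one y)%:E
   <= \int[mu]_(y in cell j x) (2 * (last_principal J j y)%:R)%:E)%E.
Proof.
move=> jJ pjx; have mc := measurable_cell j x; have o1 := nnm_one.
have vx : 0 < v j x.
  by apply: le_lt_trans pjx; rewrite mulr_ge0 ?record_ge0// (le_trans ler01).
have ll : nnm (fun y => (last_principal J j y)%:R : R).
  by apply: (@level_nnm J) => // y z yz; rewrite (level_last_principal jJ yz).
pose ex i y := exceeds one (g i) j J ((2 * n)%:R * avg one (g i) j x) y.
have ee i : nnm (fun y => (ex i y)%:R : R).
  by apply: (@level_nnm J) => // y z yz; rewrite /ex (level_exceeds _ _ _ _ yz).
have n2 : 0 < (2 * n)%:R :> R by rewrite ltr0n muln_gt0.
set S := (\int[mu]_(y in cell j x) (one y)%:E)%E.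
have /andP[S0 Sy] : (0 < S < +oo)%E := one_cell j x.
have Sf : S \is a fin_num by rewrite ge0_fin_numE// ltW.
have exS i : (\int[mu]_(y in cell j x) ((ex i y)%:R * one y)%:E
    <= ((2 * n)%:R^-1)%:E * S)%E.
  have A0 : 0 < avg one (g i) j x by exact: v_gt0.
  apply: le_trans (weak_type nnm_one one_cell (gg i) (gcell i) x _ (ltnW jJ)) _.
    by rewrite mulr_gt0.
  by rewrite -(avgE nnm_one one_cell (gg i) (gcell i)) muleA -EFinM invfM mulfVK// gt_eqF.
have : (S <= \int[mu]_(y in cell j x)
    ((last_principal J j y)%:R + \sum_(i < n) (ex i y)%:R * one y)%:E)%E.
  apply: le_integral_nnm => //; [nnm|move=> y yx].
  have s0 : 0 <= \sum_(i < n) (ex i y)%:R * one y :> R.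
    by apply: sumr_ge0 => i _; rewrite mulr1.
  rewrite /last_principal (level_principal yx) pjx/=.
  case: existsP => [[k /andP[jk pk]]|_]; last by rewrite lerDl.
  rewrite add0r; have [i Hi] : exists i, ex i y.
    apply: contrapT => nex; move: pk; apply/negP; rewrite /principal -leNgt.
    apply: (@le_trans _ _ (a * v j y)).
      apply: v_jump => [|i]; first exact: ltnW.
      rewrite leNgt; apply/negP => lt_avg; apply: nex; exists i.
      by apply/existsP; exists k; rewrite (ltnW jk)/= -(level_avg _ _ yx).
    rewrite ler_wpM2l ?(le_trans ler01)//.
    apply: le_trans (record_le _ jk).
    by rewrite (lv yx) (level_record yx) /=; move: pjx; rewrite /principal => ->.
  rewrite (bigD1 i)//= Hi mulr1 lerDl; apply: sumr_ge0 => k' _.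
  by rewrite mulr1.
rewrite integral_nnmD; [|by []|nnm|nnm].
rewrite integral_nnm_sum; [|by []|by move=> i; nnm].
rewrite integral_nnmZ; [|by []|by []|nnm].
set L := (\int[mu]_(y in cell j x) (last_principal J j y)%:R%:E)%E.
have half : (\sum_(i < n) \int[mu]_(y in cell j x) ((ex i y)%:R * one y)%:E
    <= (2^-1)%:E * S)%E.
  apply: le_trans (_ : (\sum_(i < n) ((2 * n)%:R^-1)%:E * S <= _)%E).
    by apply: lee_sum => i _; exact: exS.
  rewrite -(fineK Sf) -EFinM sumEFin sumr_const card_ord lee_fin.
  have n1 : n%:R != 0 :> R by rewrite pnatr_eq0 -lt0n.
  by rewrite -[_ *+ n]mulr_natr natrM le_eqVlt; apply/orP; left; apply/eqP; field.
move=> /le_trans => /(_ _ (leeD2l _ half)).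
have L0 : (0 <= L)%E by apply: integral_nnm_ge0.
rewrite -(fineK Sf) -EFinM; case: L L0 => [l| |]//= l0.
  rewrite -EFinM -EFinD !lee_fin => h.
  by rewrite -[in leRHS](mulr1 2) -mulrA; move: (fine S) h => S'; lra.
by rewrite gt0_muley// leey.
Qed.

Hypothesis ss : nnm s.
Hypothesis scell : forall j x, (0 < \int[mu]_(y in cell j x) (s y)%:E < +oo)%E.
Hypothesis K0 : 0 <= K.
(** An abstract form of the A-infinity condition: [h] stands for a linearization
    of the maximal function of [s] restricted to a cell. *)
Hypothesis s_Ainfty : forall i x (h : T -> R), nnm h ->
  (forall y, cell i x y -> h y = 0 \/ exists2 j, (i <= j)%N & h y = avg one s j y) ->
  (\int[mu]_(y in cell i x) (h y)%:E <= K%:E * \int[mu]_(y in cell i x) (s y)%:E)%E.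

(** Replacing [s] by its average over the cell at level [j] and then the cell by
    the part of it, at least one half, on which [j] is the last principal level
    turns the sum into an integral over disjoint sets of averages of [s]. *)
Lemma principal_carleson J i x : (i < J)%N ->
  (\int[mu]_(y in cell i x) ((\sum_(i <= j < J) (principal j y)%:R) * s y)%:E
   <= (2 * K)%:E * \int[mu]_(y in cell i x) (s y)%:E)%E.
Proof.
move=> iJ; have mc := measurable_cell i x; have o1 := nnm_one.
have s1 : nnm (fun y => s y * one y) by nnm.
have scell1 j y : (\int[mu]_(z in cell j y) (s z * one z)%:E < +oo)%E.
  have /andP[_ h] := scell j y.
  by under eq_integral do rewrite mulr1.
have pp j : nnm (fun y => (principal j y)%:R : R).
  by apply: (@level_nnm j) => // y z yz; rewrite (level_principal yz).
have ll j : (j < J)%N -> nnm (fun y => (last_principal J j y)%:R : R).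
  by move=> jJ; apply: (@level_nnm J) => // y z yz; rewrite (level_last_principal jJ yz).
have AA j : nnm (avg one s j) by exact: nnm_avg.
pose lastJ (j : nat) y : R := if (j < J)%N then (last_principal J j y)%:R else 0.
have LL j : nnm (lastJ j) by rewrite /lastJ; case: ltnP => [/ll//|_]; nnm.
have Qi j : (i <= j)%N -> forall y z, idx j y = idx j z -> cell i x y -> cell i x z.
  by move=> ij y z /(idx_le ij) yz; rewrite /cell /= -yz.
pose h y := \sum_(i <= j < J) lastJ j y * avg one s j y.
have hh : nnm h by rewrite /h; nnm.
apply: (@le_trans _ _ (\int[mu]_(y in cell i x) (2 * h y)%:E)%E); last first.
  rewrite integral_nnmZ; [|by []|by []|by []].
  rewrite EFinM -muleA lee_pmul2l// s_Ainfty// => y _.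
  have [[j [/andP[ij jJ] lj]]|nj] :=
      pselect (exists j, (i <= j < J)%N /\ last_principal J j y).
    right; exists j => //; rewrite /h (bigD1_seq j)/= ?iota_uniq//; last first.
      by rewrite mem_index_iota ij.
    rewrite /lastJ jJ lj mul1r big_seq_cond big1 ?addr0// => k.
    rewrite mem_index_iota => /andP[/andP[_ kJ] kj]; rewrite kJ.
    rewrite (_ : last_principal J k y = false) ?mul0r//.
    apply/negP => /andP[pk /existsPn lk]; move: lj => /andP[pj /existsPn lj].
    have [jk|kj'|e] := ltngtP j k; last by rewrite e eqxx in kj.
      by have := lj (Ordinal kJ); rewrite /= jk pk.
    by have := lk (Ordinal jJ); rewrite /= kj' pj.
  left; rewrite /h big_seq_cond big1// => k.
  rewrite mem_index_iota andbT => /andP[ik kJ]; rewrite /lastJ kJ.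
  case E : last_principal; last by rewrite mul0r.
  by case: nj; exists k; rewrite ik kJ.
apply: (@le_trans _ _ (\int[mu]_(y in cell i x)
    (\sum_(i <= j < J) (principal j y)%:R * avg one s j y * (2 * lastJ j y))%:E)%E); last first.
  apply: le_integral_nnm => //; [nnm|nnm|move=> y _].
  rewrite /h mulr_sumr; apply: ler_sum => j _.
  have A0 : 0 <= avg one s j y by case: (AA j).
  have L0 : 0 <= lastJ j y by case: (LL j).
  rewrite (_ : 2 * (lastJ j y * _) = avg one s j y * (2 * lastJ j y)); last by ring.
  by case: (principal j y); rewrite ?mul1r ?lexx// ?mul0r mulr_ge0// mulr_ge0.
under eq_integral do rewrite mulr_suml.
rewrite !integral_nnm_sum//; [|move=> j; nnm|move=> j; nnm].
rewrite big_seq_cond [leRHS]big_seq_cond; apply: lee_sum => j.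
rewrite mem_index_iota andbT => /andP[ij jJ].
apply: (@le_trans _ _ (\int[mu]_(y in cell i x)
    ((principal j y)%:R * avg one s j y * one y)%:E)%E); last first.
  apply: (@le_integral_cells j); [exact: Qi| | |nnm|nnm|].
  - by move=> y z yz; rewrite (level_principal yz) (level_avg _ _ yz).
  - by move=> y; rewrite mulr_ge0//; case: (AA j).
  move=> y _ py; rewrite /lastJ jJ principal_half//.
  by move: py; case: principal => //; rewrite mul0r ltxx.
under [leRHS]eq_integral do rewrite -mulrA.
apply: (@le_integral_cells j); [exact: Qi| |by []|by []|nnm|].
  by move=> y z yz; rewrite (level_principal yz).
move=> y _ _; rewrite integral_levelM//; last 2 first.
- exact: level_avg.
- by case: (AA j).
rewrite (avgE o1 one_cell ss scell1).
by under [leRHS]eq_integral do rewrite mulr1.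
Qed.

(** The weighted estimate for the record process: the testing condition on
    cells turns the sum over principal cells into a Carleson sum. *)
Lemma record_estimate (f w : T -> R) (B p r : R) J :
  nnm f -> nnm w -> 0 <= B -> 1 < p -> 0 < r ->
  (forall j x, (\int[mu]_(y in cell j x) (f y * s y)%:E < +oo)%E) ->
  (\int[mu]_x (f x `^ p * s x)%:E < +oo)%E ->
  (forall j x, ((v j x `^ r)%:E * \int[mu]_(y in cell j x) (w y)%:E
    <= (B * avg s f j x `^ p)%:E * \int[mu]_(y in cell j x) (s y)%:E)%E) ->
  (\int[mu]_x (record J x `^ r * w x)%:E
   <= (B * (2 * K * (2 `^ p / (p - 1))))%:E * \int[mu]_x (f x `^ p * s x)%:E)%E.
Proof.
move=> ff ww B0 p1 r0 fcell fp testing.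
have pp j : nnm (fun y => (principal j y)%:R : R).
  by apply: (@level_nnm j) => // y z yz; rewrite (level_principal yz).
have vv j : nnm (v j) by exact: level_nnm (@lv j) (v0 j).
have rr : nnm (record J) by exact: level_nnm (@level_recordW J) (record_ge0 J).
have AA j : nnm (avg s f j) by exact: nnm_avg.
apply: (@le_trans _ _
    (\int[mu]_x (\sum_(j < J) (principal j x)%:R * (v j x `^ r * w x))%:E)%E).
  apply: le_integral_nnm; [by []|nnm|nnm|move=> x _].
  under eq_bigr do rewrite mulrA; rewrite -mulr_suml.
  by rewrite ler_wpM2r ?record_powR_le//; case: ww.
apply: (@le_trans _ _ (\int[mu]_x
    (B * \sum_(j < J) (principal j x)%:R * (avg s f j x `^ p * s x))%:E)%E).
  under [leRHS]eq_integral do rewrite mulr_sumr.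
  rewrite !integral_nnm_sum; [|by []|by move=> i; nnm|by []|by move=> i; nnm].
  apply: lee_sum => j _; under [leRHS]eq_integral do rewrite mulrCA.
  apply: (@le_integral_cells j); [by []| |by []|nnm|nnm|].
    by move=> x y xy; rewrite (level_principal xy).
  move=> x _ _; rewrite integral_levelM; [|by move=> y z /lv ->|by move=> y; exact: powR_ge0|by []].
  under [leRHS]eq_integral do rewrite mulrA.
  rewrite integral_levelM; [exact: testing| | |by []].
    by move=> y z yz; rewrite (level_avg _ _ yz).
  by move=> y; rewrite mulr_ge0 ?powR_ge0.
rewrite integral_nnmZ; [|by []|by []|nnm].
rewrite EFinM -muleA lee_wpmul2l ?lee_fin//.
apply: (carleson_embedding ss scell ff fcell level_principal _ p1); last exact: fp.
  by rewrite mulr_ge0.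
exact: principal_carleson.
Qed.

End PrincipalCells.
End NestedPartitions.

(** * Half-open cubes and shifted dyadic grids *)

Section HalfOpenCubes.
Variable R : realType.
Local Notation Rm := (measurableTypeR R).

Definition hcube d (a : d.-tuple R) (l : R) : set (d.-tuple Rm) :=
  [set x | forall i, tnth a i <= tnth x i < tnth a i + l].

Lemma borel_measurable_hcube d (a : d.-tuple R) (l : R) : measurable (hcube a l).
Proof.
rewrite (_ : hcube a l = \big[setI/setT]_(i < d)
    ((@tnth d Rm ^~ i) @^-1` [set` `[tnth a i, (tnth a i + l)%R[])).
  apply: bigsetI_measurable => i _; rewrite -[X in measurable X]setTI.
  exact: measurable_tnth.
rewrite -bigcap_seq; apply/seteqP; split=> x /= xa i; first by move=> _; exact: xa.
by have := xa i (mem_index_enum i); rewrite ?in_itv.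
Qed.

Lemma borel_leb_hcube d (a : d.-tuple R) (l : R) : 0 < l ->
  @borel_leb R d (hcube a l) = (l ^+ d)%:E.
Proof.
move=> l0; elim: d a => [|d IH] a.
  by rewrite /= diracE expr0 mem_set// => -[].
case/tupleP: a => a0 a; rewrite [LHS]/= /pushforward.
rewrite (_ : _ @^-1` _ = [set` `[a0, (a0 + l)%R[] `*` hcube a l); last first.
  apply/seteqP; split=> -[x y] /=; rewrite /hcube/= in_itv/=.
    move=> xya; split=> [|i]; first by have := xya ord0.
    by have := xya (lift ord0 i); rewrite !tnthS.
  move=> [xa ya] i; case: (unliftP ord0 i) => [j ->|->]; last by rewrite !tnth0.
  by rewrite !tnthS.
rewrite product_measure1E//; last exact: borel_measurable_hcube.
rewrite [X in (_ * X)%E]IH /= lebesgue_measure_itv/= lte_fin ltrDl l0 -EFinB.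
by rewrite addrAC subrr add0r -EFinM exprS.
Qed.

Variable d : nat.
Local Notation Rd := (Rd R d).

Lemma measurable_hcube (a : d.-tuple R) l : measurable (hcube a l : set Rd).
Proof.
apply: sub_caratheodory; apply: sub_sigma_algebra; exact: borel_measurable_hcube.
Qed.

Lemma leb_hcube (a : d.-tuple R) l : 0 < l -> leb (hcube a l : set Rd) = (l ^+ d)%:E.
Proof.
move=> l0; rewrite -(borel_leb_hcube a l0) /leb /completed_measure_extension.
apply: measurable_mu_extE; exact: borel_measurable_hcube.
Qed.

Lemma hcube_sub_cube (a : d.-tuple R) l : (hcube a l : set Rd) `<=` cube a l.
Proof. by move=> x xa i; have /andP[-> /ltW] := xa i. Qed.

Lemma vol_cube (a : d.-tuple R) l : 0 < l -> vol (cube a l) = l ^+ d.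
Proof. by move=> l0; rewrite /vol leb_cube. Qed.

Lemma integral_cst_cube (c : R) (a : d.-tuple R) l : 0 < l ->
  (\int[leb]_(x in (cube a l : set Rd)) c%:E = (c * l ^+ d)%:E)%E.
Proof.
move=> l0; rewrite EFinM -(leb_cube a l0).
exact: (@integral_cst _ _ _ leb _ (measurable_cube a l) c%:E).
Qed.

(** The boundary of a cube is a null set. *)
Lemma integral_hcube (a : d.-tuple R) l (f : Rd -> R) : 0 < l -> nnm f ->
  (\int[leb]_(x in hcube a l) (f x)%:E = \int[leb]_(x in cube a l) (f x)%:E)%E.
Proof.
move=> l0 [mf f0].
have mH := measurable_hcube a l; have mC := measurable_cube a l.
have mD : measurable (cube a l `\` (hcube a l : set Rd)) by exact: measurableD.
have mfD (D : set Rd) : measurable_fun D (fun x => (f x)%:E).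
  by apply: (@measurable_funTS _ _ _ _ D); apply/measurable_EFinP.
rewrite -(setDUK (@hcube_sub_cube a l)) ge0_integral_setU//; last 2 first.
- by move=> x _; rewrite lee_fin.
- by apply/disj_setPLR => x xa [_]; apply.
rewrite [X in (_ = _ + X)%E](_ : _ = 0%E) ?adde0//.
apply: null_set_integral => //.
rewrite measureD//; last by rewrite [X in (X < _)%E](leb_cube a l0) ltry.
rewrite (setIidr (@hcube_sub_cube a l)).
rewrite [X in (X - _)%E](leb_cube a l0) [X in (_ - X)%E](leb_hcube a l0).
by rewrite subee.
Qed.

End HalfOpenCubes.

Section Grid.
Variables (R : realType) (d N : nat) (tau : {ffun 'I_d -> bool}).
Local Notation Rd := (Rd R d).

Definition side j : R := 2 ^+ N / 2 ^+ j.

Definition shift (i : 'I_d) : R := if tau i then 2 ^+ N / 3 else 0.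

(** The cubes of side [side j], [j = 0, 1, ...], of the standard dyadic grid,
    translated coordinatewise by [0] or by a third of the largest side. *)
Definition grid j (x : Rd) : d.-tuple int :=
  [tuple Num.floor ((tnth (x : d.-tuple R) i - shift i) / side j) | i < d].

Definition corner j (x : Rd) : d.-tuple R :=
  [tuple shift i + side j * (tnth (grid j x) i)%:~R | i < d].

Lemma side_gt0 j : 0 < side j.
Proof. by rewrite divr_gt0// exprn_gt0. Qed.

Lemma side_le i j : (i <= j)%N -> side j <= side i.
Proof.
move=> ij; rewrite ler_pM2l ?exprn_gt0// lef_pV2 ?posrE ?exprn_gt0//.
by rewrite ler_weXn2l// ler1n.
Qed.

Lemma cell_grid j x : cell grid j x = hcube (corner j x) (side j).
Proof.
have s0 := side_gt0 j.
have E (y : Rd) i : tnth (corner j x) i <= tnth (y : d.-tuple R) i < tnth (corner j x) i + side j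
    = (tnth (grid j x) i == tnth (grid j y) i).
  rewrite tnth_mktuple (tnth_mktuple (fun i => Num.floor ((tnth (y : d.-tuple R) i - _) / _))).
  rewrite [RHS]eq_sym floor_eq ler_pdivlMr// ltr_pdivrMr// lerBrDl ltrBlDl.
  by rewrite intrD mulrDl mul1r addrA ![_%:~R * _]mulrC.
apply/seteqP; split=> y /=.
  by move=> yx i; rewrite E yx.
by move=> yx; apply/esym/eq_from_tnth => i; apply/eqP; rewrite -E; exact: yx.
Qed.

Lemma measurable_grid j k : measurable [set x : Rd | grid j x = k].
Proof.
have [[x <-]|nx] := pselect (exists x, grid j x = k).
  by rewrite -/(cell grid j x) cell_grid; exact: measurable_hcube.
rewrite (_ : mkset _ = set0)//; apply/seteqP; split=> // x xk; case: nx.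
by exists x.
Qed.

Lemma grid_nested j x y : grid j.+1 x = grid j.+1 y -> grid j x = grid j y.
Proof.
move=> xy; apply: eq_from_tnth => i; have := congr1 (fun t => tnth t i) xy.
rewrite !tnth_mktuple.
(* taking integer parts commutes with halving, so that the index at level [j]
   is a function of the index at level [j.+1] *)
have half (z : R) : Num.floor (z / side j) = (Num.floor (z / side j.+1) %/ 2)%Z.
  have -> : z / side j.+1 = z / side j * 2.
    by rewrite /side exprS; field; rewrite !expf_neq0.
  move: (z / side j) => u; apply/eqP; rewrite floor_eq.
  have /andP[] := floor_itv (u * 2); move: (Num.floor _) => m mu um.
  have := divz_eq m 2; have := modz_ge0 m (isT : 2 != 0 :> int).
  have := @ltz_mod m 2 isT; rewrite /=.
  move: (m %/ 2)%Z (m %% 2)%Z => k e e2 e0 mE.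
  move: mu um; rewrite mE !intrD intrM.
  have e0' : 0 <= e%:~R :> R by rewrite ler0z.
  have e1' : e%:~R <= 1 :> R by rewrite -[1]/(1%:~R) ler_int -ltzD1.
  by move=> h1 h2; apply/andP; split; lra.
by rewrite !half => ->.
Qed.

Lemma corner_in_cell j x : cell grid j x `<=` cube (corner j x) (side j).
Proof. by rewrite cell_grid; exact: hcube_sub_cube. Qed.

Lemma integral_cell_grid j x (f : Rd -> R) : nnm f ->
  (\int[leb]_(y in cell grid j x) (f y)%:E
   = \int[leb]_(y in cube (corner j x) (side j)) (f y)%:E)%E.
Proof. by move=> ff; rewrite cell_grid integral_hcube// side_gt0. Qed.

End Grid.

(** The one-third trick. If a short interval met the boundaries of both the grid
    of mesh [D / 2 ^+ j] and its translate by [D / 3], a power of 2 would be a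
    multiple of 3. *)
Lemma one_third (R : realType) (D l a : R) j : 0 < D -> 0 < l ->
  3 * l <= D / 2 ^+ j ->
  exists t : bool, forall y, a <= y <= a + l ->
    Num.floor ((y - (if t then D / 3 else 0)) / (D / 2 ^+ j))
    = Num.floor ((a - (if t then D / 3 else 0)) / (D / 2 ^+ j)).
Proof.
move=> D0 l0 l3; have p0 : 0 < 2 ^+ j :> R by rewrite exprn_gt0.
set s := D / 2 ^+ j; have s0 : 0 < s by rewrite divr_gt0.
have cut (t : R) : (exists2 k : int, a < s * k%:~R + t & s * k%:~R + t <= a + l) \/
    forall y, a <= y <= a + l -> Num.floor ((y - t) / s) = Num.floor ((a - t) / s).
  have [|nk] := pselect (exists2 k : int, a < s * k%:~R + t & s * k%:~R + t <= a + l).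
    by left.
  right=> y /andP[ay yl]; apply: contrapT => /eqP neq; apply: nk.
  exists (Num.floor ((y - t) / s)).
    have : Num.floor ((a - t) / s) < Num.floor ((y - t) / s).
      by rewrite lt_neqAle eq_sym neq le_floor// ler_pM2r ?invr_gt0// lerB.
    by rewrite floor_lt_int ltr_pdivrMr// mulrC ltrBlDr.
  have := floor_le ((y - t) / s); rewrite ler_pdivlMr// mulrC lerBrDr => h.
  exact: le_trans h yl.
have [[k k1 k2]|h0] := cut 0; last by exists false.
have [[m m1 m2]|h1] := cut (D / 3); last by exists true.
exfalso.
have DE : D = s * 2 ^+ j by rewrite /s mulfVK// gt_eqF.
have zE : (3 * (k - m) - 2 ^+ j)%:~R = 3 * (k%:~R - m%:~R) - 2 ^+ j :> R.
  by rewrite rmorphB rmorphM rmorphB rmorphXn.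
move: k1 k2 m1 m2 l3; rewrite [in D / 3]DE -/s => k1 k2 m1 m2 l3.
have z1 : (-1)%:~R < (3 * (k - m) - 2 ^+ j)%:~R :> R.
  by rewrite zE -(ltr_pM2l s0) [(-1)%:~R]rmorphN; lra.
have z2 : (3 * (k - m) - 2 ^+ j)%:~R < 1%:~R :> R.
  by rewrite zE -(ltr_pM2l s0); lra.
move: z1 z2; rewrite !ltr_int => z1 z2.
have : (3 %| 2 ^+ j)%Z.
  apply/dvdzP; exists (k - m); move: (2 ^+ j) z1 z2 => P; lia.
by rewrite dvdzE abszX Euclid_dvdX.
Qed.

(** Every cube lies in a comparable cube of one of the shifted grids, as soon as
    the largest scale of the grid is large and the smallest one is small. *)
Lemma cube_in_grid (R : realType) d (a : d.-tuple R) l : 0 < l ->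
  exists N0, forall N, (N0 <= N)%N ->
  exists tau : {ffun 'I_d -> bool}, exists2 j, (j < (2 * N).+1)%N &
    [/\ l <= side R N j, side R N j <= 6 * l & forall x : Rd R d,
      cube a l x -> cube a l `<=` cell (@grid R d N tau) j x].
Proof.
move=> l0; pose N0 := (Num.truncn (3 * l) + Num.truncn l^-1).+1.
have big (u : R) N : (Num.truncn u < N)%N -> u <= 2 ^+ N.
  move=> uN; apply: le_trans (ltW (truncnS_gt u)) _.
  rewrite -natrX ler_nat; apply: leq_trans uN _; exact/ltnW/ltn_expl.
exists N0 => N N0N.
have b1 : 3 * l <= 2 ^+ N.
  by apply: big; apply: leq_trans N0N; rewrite ltnS leq_addr.
have b2 : l^-1 <= 2 ^+ N.
  by apply: big; apply: leq_trans N0N; rewrite ltnS leq_addl.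
have b3 : side R N (2 * N) <= l.
  rewrite /side mul2n -addnn exprD invfM mulrA divff ?expf_neq0// mul1r.
  by rewrite -[leRHS]invrK lef_pV2 ?posrE ?invr_gt0 ?exprn_gt0.
pose P j := (j <= 2 * N)%N && (3 * l <= side R N j).
have P0 : exists j, P j by exists 0%N; rewrite /P /side expr0 divr1 b1.
have PN j : P j -> (j <= 2 * N)%N by case/andP.
case: (ex_maxnP P0 PN) => j /andP[jN l3] jmax.
have s6 : side R N j <= 6 * l.
  have [jlt|jge] := ltnP j (2 * N).
    have := contra (@jmax j.+1); rewrite -ltnNge ltnSn => /(_ isT).
    rewrite /P jlt/= -ltNge => h.
    have -> : side R N j = 2 * side R N j.+1.
      by rewrite /side exprS; field; rewrite expf_neq0.
    lra.
  apply: le_trans (side_le R N jge) _; lra.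
have D0 : 0 < 2 ^+ N :> R by rewrite exprn_gt0.
have /= tauP i := one_third (tnth a i) D0 l0 l3.
exists [ffun i => projT1 (cid (tauP i))]; exists j => //.
split=> //; first lra.
move=> x xa y ya; apply: eq_from_tnth => i; rewrite !tnth_mktuple /shift ffunE.
case: cid => t /= ht.
by rewrite /side (ht _ (ya i)) (ht _ (xa i)).
Qed.

(** * The maximal function *)

Lemma limn_einf_ge (R : realType) (u : nat -> \bar R) c N0 :
  (forall N, (N0 <= N)%N -> (c <= u N)%E) -> (c <= limn_einf u)%E.
Proof.
move=> cu; rewrite limn_einf_lim; apply: lime_ge; first exact: is_cvg_einfs.
exists N0 => // m /= N0m; apply: le_ereal_inf_tmp => _ [k /= mk <-].
by apply: cu; exact: leq_trans mk.
Qed.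

Lemma limn_einf_le (R : realType) (u : nat -> \bar R) c :
  (forall N, (u N <= c)%E) -> (limn_einf u <= c)%E.
Proof.
move=> uc; rewrite limn_einf_lim; apply: lime_le; first exact: is_cvg_einfs.
apply: nearW => m; apply: le_trans (uc m); apply: ereal_inf_lbound.
by exists m => //=.
Qed.

Section MaximalEstimate.
Variables (R : realType) (n d : nat) (alpha : R).
Local Notation Rd := (Rd R d).
Variables (f s : 'I_n -> Rd -> R) (w : Rd -> R) (i0 : 'I_n).
Variables (B K p r : R).

Definition mean (u : Rd -> R) (a : d.-tuple R) l : R :=
  fine (\int[leb]_(y in cube a l) (u y)%:E) / l ^+ d.

(** The value that the cube contributes to the multilinear maximal function. *)
Definition multi_mean (a : d.-tuple R) l : R :=
  (l ^+ d) `^ (alpha / d%:R) * \prod_(i < n) mean (fun y => f i y * s i y) a l.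

Hypothesis alpha0 : 0 <= alpha.
Hypothesis ff : forall i, nnm (f i).
Hypothesis ss : forall i, nnm (s i).
Hypothesis ww : nnm w.
Hypothesis B0 : 0 <= B.
Hypothesis K0 : 0 <= K.
Hypothesis p1 : 1 < p.
Hypothesis r0 : 0 < r.
Hypothesis scube : forall a l, 0 < l ->
  (0 < \int[leb]_(y in cube a l) (s i0 y)%:E < +oo)%E.
Hypothesis fscube : forall i a l, 0 < l ->
  (\int[leb]_(y in cube a l) (f i y * s i y)%:E < +oo)%E.
Hypothesis fp : (\int[leb]_x (f i0 x `^ p * s i0 x)%:E < +oo)%E.
Hypothesis testing : forall a l, 0 < l ->
  ((multi_mean a l `^ r)%:E * \int[leb]_(y in cube a l) (w y)%:E
  <= (B * (fine (\int[leb]_(y in cube a l) (f i0 y * s i0 y)%:E)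
           / fine (\int[leb]_(y in cube a l) (s i0 y)%:E)) `^ p)%:E
     * \int[leb]_(y in cube a l) (s i0 y)%:E)%E.
Hypothesis s_Ainfty : forall a l (h : Rd -> R), 0 < l -> nnm h ->
  (forall y, cube a l y -> h y = 0 \/
    exists a' l', [/\ 0 < l', hcube a' l' `<=` (cube a l : set (d.-tuple _)),
      cube a' l' y & h y = mean (s i0) a' l']) ->
  (\int[leb]_(y in cube a l) (h y)%:E
   <= K%:E * \int[leb]_(y in cube a l) (s i0 y)%:E)%E.

Let n0 : (0 < n)%N. Proof. by case: n i0 => [[]|]. Qed.

Let one : Rd -> R := fun=> 1.

Let one_nnm : nnm one. Proof. exact: nnm_cst. Qed.

Let fs_nnm i : nnm (fun y => f i y * s i y). Proof. exact: nnmM. Qed.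

Lemma mean_ge0 u a l : 0 < l -> nnm u -> 0 <= mean u a l.
Proof.
move=> l0 uu; rewrite divr_ge0 ?exprn_ge0 ?(ltW l0)//.
by rewrite fine_ge0// integral_nnm_ge0.
Qed.

Lemma multi_mean_ge0 a l : 0 < l -> 0 <= multi_mean a l.
Proof.
move=> l0; rewrite mulr_ge0 ?powR_ge0// prodr_ge0// => i _.
exact: mean_ge0.
Qed.

Section OneGrid.
Variables (N : nat) (tau : {ffun 'I_d -> bool}).
Local Notation gr := (@grid R d N tau).
Local Notation gavg := (avg leb gr).

Let v j x := multi_mean (corner N tau j x) (side R N j).

Let side0 j : 0 < side R N j. Proof. exact: side_gt0. Qed.

Let mgr := @measurable_grid R d N tau.
Let nestgr := @grid_nested R d N tau.

(* if each of the [n] averages grows at most by the factor [2 * n], their product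
   grows at most by the factor [jump] *)
Let jump : R := ((2 * n) ^ n)%:R.

Let integral_cellE j x (u : Rd -> R) : nnm u ->
  (\int[leb]_(y in cell gr j x) (u y)%:E
   = \int[leb]_(y in cube (corner N tau j x) (side R N j)) (u y)%:E)%E.
Proof. exact: integral_cell_grid. Qed.

Let avg_one u j x : nnm u -> gavg one u j x = mean u (corner N tau j x) (side R N j).
Proof.
move=> uu; rewrite /avg/= /mean; congr (fine _ / _).
  by under eq_integral do rewrite mulr1; exact: integral_cellE.
by rewrite (integral_cellE _ _ one_nnm) integral_cst_cube// mul1r.
Qed.

Let lv j : level gr j (v j).
Proof. by move=> x y xy; rewrite /v /corner xy. Qed.

Let v0 j x : 0 <= v j x. Proof. exact: multi_mean_ge0. Qed.

Let jump1 : 1 <= jump.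
Proof. by rewrite ler1n expn_gt0 muln_gt0 n0. Qed.

Let one_cell j x : (0 < \int[leb]_(y in cell gr j x) (one y)%:E < +oo)%E.
Proof.
by rewrite (integral_cellE _ _ one_nnm) integral_cst_cube// mul1r lte_fin exprn_gt0 ?ltry.
Qed.

Let g i x := f i x * s i x.
Let gg i : nnm (g i). Proof. exact: fs_nnm. Qed.

Let gcell i j x : (\int[leb]_(y in cell gr j x) (g i y * one y)%:E < +oo)%E.
Proof.
under eq_integral do rewrite mulr1.
by rewrite (integral_cellE _ _ (fs_nnm i)); exact: fscube.
Qed.

Let v_jump j k x : (j <= k)%N ->
  (forall i, gavg one (g i) k x <= (2 * n)%:R * gavg one (g i) j x) ->
  v k x <= jump * v j x.
Proof.
move=> jk h; have {}h i : mean (g i) (corner N tau k x) (side R N k)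
    <= (2 * n)%:R * mean (g i) (corner N tau j x) (side R N j).
  by rewrite -!(avg_one _ _ (gg i)).
rewrite /v /multi_mean mulrCA ler_pM ?powR_ge0//.
- by apply: prodr_ge0 => i _; exact: mean_ge0.
- rewrite ge0_ler_powR ?nnegrE ?divr_ge0 ?exprn_ge0 ?(ltW (side0 _))//.
  by rewrite lerXn2r ?nnegrE ?(ltW (side0 _))// side_le.
rewrite /jump natrX -[n in _ ^+ n]card_ord -prodr_const -big_split/=.
by apply: ler_prod => i _; rewrite mean_ge0// h.
Qed.

Let v_gt0 i j x : 0 < v j x -> 0 < gavg one (g i) j x.
Proof.
rewrite (avg_one _ _ (gg i)) /v /multi_mean => vx; rewrite lt_neqAle mean_ge0// andbT.
apply/eqP => e; move: vx; rewrite (bigD1 i)//= -/(g i) -e.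
by rewrite mul0r mulr0 ltxx.
Qed.

Let scell j x : (0 < \int[leb]_(y in cell gr j x) (s i0 y)%:E < +oo)%E.
Proof. by rewrite (integral_cellE _ _ (ss i0)); exact: scube. Qed.

Let s_Ainfty_cell i x (h : Rd -> R) : nnm h ->
  (forall y, cell gr i x y -> h y = 0 \/
     exists2 j, (i <= j)%N & h y = gavg one (s i0) j y) ->
  (\int[leb]_(y in cell gr i x) (h y)%:E
   <= K%:E * \int[leb]_(y in cell gr i x) (s i0 y)%:E)%E.
Proof.
move=> hh hP; pose ind y : R := \1_(cell gr i x) y.
have mc : measurable (cell gr i x) by exact: mgr.
have ind_nnm : nnm ind.
  by split=> [|y]; [exact: measurable_indic|rewrite /ind indicE ler0n].
have -> : (\int[leb]_(y in cell gr i x) (h y)%:E =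
    \int[leb]_(y in cell gr i x) (h y * ind y)%:E)%E.
  by apply: eq_integral => y yx; rewrite /ind indicE yx mulr1.
have hi : nnm (fun y => h y * ind y) by exact: nnmM.
rewrite (integral_cellE _ _ (ss i0)) (integral_cellE _ _ hi).
apply: s_Ainfty; [exact: side0|exact: hi|move=> y _].
 rewrite /ind indicE.
have [yx|] := boolP (y \in cell gr i x); last by rewrite mulr0; left.
rewrite mulr1; move: yx; rewrite inE => yx.
have [->|[j ij ->]] := hP y yx; first by left.
right; exists (corner N tau j y), (side R N j); split=> //.
- rewrite -cell_grid => z zy; apply: corner_in_cell.
  have e := idx_le nestgr ij zy.
  by move: yx; rewrite /cell /= -e.
- exact: corner_in_cell.
- exact: avg_one.
Qed.

Definition grid_record J x := record v jump J x.

Lemma nnm_grid_record J : nnm (grid_record J).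
Proof.
apply: (level_nnm mgr (@level_recordW _ _ _ _ _ nestgr v jump lv J)).
by move=> x; exact: (record_ge0 jump v0).
Qed.

Lemma le_grid_record j J x : (j < J)%N ->
  multi_mean (corner N tau j x) (side R N j) <= jump * grid_record J x.
Proof. exact: (le_record v0 jump1). Qed.

Lemma grid_record_estimate J :
  (\int[leb]_x (grid_record J x `^ r * w x)%:E
   <= (B * (2 * K * (2 `^ p / (p - 1))))%:E * \int[leb]_x (f i0 x `^ p * s i0 x)%:E)%E.
Proof.
have fscell j x : (\int[leb]_(y in cell gr j x) (f i0 y * s i0 y)%:E < +oo)%E.
  by rewrite (integral_cellE _ _ (fs_nnm i0)); exact: fscube.
have tests j x : ((v j x `^ r)%:E * \int[leb]_(y in cell gr j x) (w y)%:E
    <= (B * gavg (s i0) (f i0) j x `^ p)%:E * \int[leb]_(y in cell gr j x) (s i0 y)%:E)%E.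
  rewrite /avg (integral_cellE _ _ (fs_nnm i0)).
  rewrite (integral_cellE _ _ (ss i0)) (integral_cellE _ _ ww); exact: testing.
exact: (record_estimate mgr nestgr v0 lv jump1 n0 one_cell gg gcell v_jump v_gt0
  (ss i0) scell K0 s_Ainfty_cell J (ff i0) ww B0 p1 r0 fscell fp tests).
Qed.

End OneGrid.

(** Passing from a cube to the comparable cube of a grid that contains it. *)
Lemma multi_mean_le_grid a l x : 0 < l -> cube a l x ->
  exists N0, forall N, (N0 <= N)%N -> exists tau,
    multi_mean a l <= (6 ^ (d * n) * (2 * n) ^ n)%:R * grid_record N tau (2 * N).+1 x.
Proof.
move=> l0 xa; have [N0 H] := cube_in_grid a l0; exists N0 => N /H.
move=> [tau [j jN [ls s6 sub]]]; exists tau.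
have side0 : 0 < side R N j by exact: side_gt0.
rewrite natrM -mulrA; apply: le_trans (ler_wpM2l _ (le_grid_record N tau x jN)) => //.
rewrite /multi_mean mulrCA; apply: ler_pM; rewrite ?powR_ge0//.
- by apply: prodr_ge0 => i _; apply: mean_ge0 => //; nnm.
- rewrite ge0_ler_powR ?nnegrE ?divr_ge0 ?exprn_ge0 ?(ltW side0) ?(ltW l0)//.
  by rewrite lerXn2r ?nnegrE ?(ltW side0) ?(ltW l0).
rewrite natrX exprM -[n in _ ^+ n]card_ord -prodr_const -big_split/=.
apply: ler_prod => i _; rewrite mean_ge0//=.
set u := fun y => _; have uu : nnm u by exact: fs_nnm.
rewrite /mean mulrCA; apply: ler_pM; rewrite ?fine_ge0 ?integral_nnm_ge0//.
- by rewrite invr_ge0 exprn_ge0// ltW.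
- apply: fine_le.
  + by rewrite ge0_fin_numE ?integral_nnm_ge0// fscube.
  + by rewrite ge0_fin_numE ?integral_nnm_ge0// fscube.
  rewrite -(@integral_cell_grid R d N tau j x u uu).
  by apply: (subset_integral_nnm _ _ _ uu (sub x xa));
    [exact: measurable_cube|exact: measurable_grid].
- rewrite ler_pdivlMr ?exprn_gt0// mulrC ler_pdivrMr ?exprn_gt0// -exprMn.
  by rewrite lerXn2r ?nnegrE ?(ltW side0) ?mulr_ge0 ?(ltW l0).
Qed.

(** The contribution of a cube is controlled by the grids of every large index
    [N], and the integral over one grid is bounded independently of [N]: the lower
    limit [H] of the grid bounds inherits both properties, by Fatou's lemma. *)
Theorem maximal_estimate : exists H : Rd -> \bar R,
  [/\ forall x, (0 <= H x)%E, measurable_fun setT H,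
      (\int[leb]_x H x <= (((6 ^ (d * n) * (2 * n) ^ n)%:R `^ r * 2 ^+ d)
        * (B * (2 * K * (2 `^ p / (p - 1)))))%:E
        * \int[leb]_x (f i0 x `^ p * s i0 x)%:E)%E &
      forall x a l, 0 < l -> cube a l x -> ((multi_mean a l `^ r * w x)%:E <= H x)%E].
Proof.
set c := (6 ^ (d * n) * (2 * n) ^ n)%:R; have c0 : 0 <= c :> R by exact: ler0n.
have w0 x : 0 <= w x by case: ww.
pose h N x : R := \sum_tau c `^ r * (grid_record N tau (2 * N).+1 x `^ r * w x).
have rr N tau J := nnm_grid_record N tau J.
have hh N : nnm (h N).
  by apply: nnm_sum => tau; have := rr N tau (2 * N).+1; have := powR_ge0 c r; nnm.
have mh N : measurable_fun [set: Rd] (fun x => (h N x)%:E).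
  by apply/measurable_EFinP; case: (hh N).
exists (fun x => limn_einf (fun N => (h N x)%:E)); split.
- by move=> x; apply: (@limn_einf_ge _ _ _ 0) => N _; rewrite lee_fin; case: (hh N).
- apply: (emeasurable_fun_cvg (fun k x => einfs (fun N => (h N x)%:E) k)).
    exact: measurable_fun_einfs.
  by move=> x _; rewrite limn_einf_lim; exact: is_cvg_einfs.
- have h0 N x : [set: Rd] x -> (0 <= (h N x)%:E)%E.
    by rewrite lee_fin; case: (hh N).
  apply: le_trans (fatou leb measurableT mh h0) _.
  apply: limn_einf_le => N.
  have mE tau : nnm (fun x => grid_record N tau (2 * N).+1 x `^ r * w x).
    by have := rr N tau (2 * N).+1; nnm.
  rewrite integral_nnm_sum; [|by []|by move=> tau; have := powR_ge0 c r; nnm].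
  apply: le_trans (_ : (\sum_(tau : {ffun 'I_d -> bool}) (c `^ r)%:E *
      ((B * (2 * K * (2 `^ p / (p - 1))))%:E *
       \int[leb]_x (f i0 x `^ p * s i0 x)%:E) <= _)%E).
    apply: lee_sum => tau _; rewrite integral_nnmZ; [|by []|exact: powR_ge0|by []].
    by rewrite lee_wpmul2l ?lee_fin ?powR_ge0//; exact: grid_record_estimate.
  have : (\int[leb]_x (f i0 x `^ p * s i0 x)%:E)%E \is a fin_num.
    by rewrite ge0_fin_numE; [exact: fp|apply: integral_nnm_ge0; nnm].
  move=> /fineK <-; set I := fine _; rewrite -!EFinM sumEFin lee_fin.
  rewrite sumr_const (_ : #|_| = (2 ^ d)%N); last first.
    by rewrite card_ffun card_bool card_ord.
  rewrite -[leLHS]mulr_natr natrX.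
  by rewrite le_eqVlt; apply/orP; left; apply/eqP; ring.
- move=> x a l l0 xa; have [N0 HN] := multi_mean_le_grid l0 xa.
  apply: (@limn_einf_ge _ _ _ N0) => N /HN[tau le_tau]; rewrite lee_fin.
  rewrite /h (bigD1 tau)//= -[leLHS]addr0 lerD//; last first.
    by apply: sumr_ge0 => t _; rewrite !mulr_ge0 ?powR_ge0.
  have g0 : 0 <= grid_record N tau (2 * N).+1 x by case: (rr N tau (2 * N).+1).
  rewrite mulrA ler_wpM2r// -powRM//.
  by rewrite ge0_ler_powR ?nnegrE ?multi_mean_ge0 ?mulr_ge0// ltW.
Qed.

End MaximalEstimate.

(** * Lower integrals *)

(** The integral of a nonnegative function being a supremum over simple
    functions, monotonicity holds for arbitrary functions. *)
Lemma le_integral_any d0 (T : measurableType d0) (R : realType)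
    (mu : {measure set T -> \bar R}) (D : set T) (f g : T -> \bar R) :
  (forall x, D x -> (0 <= g x)%E) -> (forall x, D x -> (f x <= g x)%E) ->
  (\int[mu]_(x in D) f x <= \int[mu]_(x in D) g x)%E.
Proof.
move=> g0 fg.
have ge0_case (h : T -> \bar R) : (forall x, D x -> (0 <= h x)%E) ->
    (forall x, D x -> (h x <= g x)%E) ->
    (\int[mu]_(x in D) h x <= \int[mu]_(x in D) g x)%E.
  move=> h0 hg; rewrite !(integral_mkcond D) !ge0_integralTE; first last.
  - by move=> x; exact: erestrict_ge0.
  - by move=> x; exact: erestrict_ge0.
  apply: le_ereal_sup => _ [k hk <-]; exists k => // x.
  exact: le_trans (hk x) (lee_restrict hg x).
rewrite integralE; apply: (@le_trans _ _ (\int[mu]_(x in D) f^\+ x)%E).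
  by rewrite -[leRHS]adde0 leeD2l// oppe_le0 integral_ge0.
apply: ge0_case => x Dx; first exact: funepos_ge0.
by rewrite funeposE ge_max fg// g0.
Qed.

(** * Growth functions *)

Section Growth.
Variable R : realType.
Implicit Types Phi Psi : R -> R.

Lemma RplusE (t : R) : (t \in (Rplus : set R)) = (0 <= t).
Proof. by apply/idP/idP; rewrite inE /Rplus/= in_itv/= andbT. Qed.

Lemma powRV (t p : R) : 0 < t -> t^-1 `^ p = (t `^ p)^-1.
Proof.
move=> t0; have tp : t `^ p != 0 by rewrite gt_eqF ?powR_gt0.
apply: (mulIf tp); rewrite mulVf// -powRM ?invr_ge0 ?(ltW t0)//.
by rewrite mulVf ?gt_eqF// powR1.
Qed.

Definition power_like p c0 c1 Phi :=
  forall t, 0 <= t -> c0 * t `^ p <= Phi t <= c1 * t `^ p.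

Lemma growth_homo Phi s t : growth Phi -> 0 <= s -> s <= t -> Phi s <= Phi t.
Proof.
move=> [_ _ _ hPhi _] s0 st; apply: (hPhi s t _ _ st); rewrite RplusE//.
exact: le_trans s0 st.
Qed.

Lemma growth_ge0 Phi t : growth Phi -> 0 <= t -> 0 <= Phi t.
Proof.
case=> fPhi _ _ _ _; rewrite -!RplusE !inE; exact: fPhi.
Qed.

Lemma growth0 Phi : growth Phi -> Phi 0 = 0.
Proof.
move=> gPhi; have [_ _ _ _ sPhi] := gPhi.
have [] := sPhi 0; first by rewrite /Rplus/= in_itv/= lexx.
move=> t; rewrite /Rplus/= in_itv/= andbT => t0 Pt.
apply/eqP; rewrite eq_le growth_ge0// andbT -[leRHS]Pt.
exact: growth_homo.
Qed.

Lemma ginv_ge0 Phi u : growth Phi -> 0 <= u -> 0 <= ginv Phi u.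
Proof.
case=> _ _ _ _ sPhi; rewrite -!RplusE !inE => u0.
by apply: (surjpinv_image_sub sPhi); exists u.
Qed.

Lemma ginvK Phi u : growth Phi -> 0 <= u -> Phi (ginv Phi u) = u.
Proof. by case=> _ _ _ _ sPhi u0; apply: (surjpK _ sPhi); rewrite RplusE. Qed.

(** Applying the last condition in the definition of the class with [t = s]
    bounds [Phi] from below by a power on [1, +oo[; with [s = 1] it bounds [Phi]
    from above on ]0, 1]. The upper type gives the two other bounds with the same
    exponent. *)
Lemma Utilde_power_like Phi : Utilde Phi ->
  exists p c0 c1, [/\ 1 <= p, 0 < c0, 0 < c1 & power_like p c0 c1 Phi].
Proof.
move=> [p p1 [[gPhi [p0 [C C0 CPhi]] _] _ [C' C'0 C'Phi]]].
have PhiS := growth_homo gPhi; have Phi0 := growth_ge0 gPhi.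
have Phi1 : 0 < Phi 1.
  rewrite lt_neqAle Phi0// andbT; apply/eqP => Phi1.
  have [_ [t t0 tneq] _ _ _] := gPhi.
  move: tneq; apply/negP; rewrite negbK eq_le (Phi0 _ t0) andbT.
  have [t1|/ltW t1] := leP 1 t.
    by have := CPhi 1 t ltr01 t1; rewrite mul1r -Phi1 mulr0.
  by rewrite Phi1; exact: PhiS.
exists p, (Num.min (Phi 1 / C) (Phi 1 / C')), (Num.max (C * Phi 1) (C' * Phi 1)).
split=> //.
- by rewrite lt_min !divr_gt0.
- by rewrite lt_max mulr_gt0.
move=> t; rewrite le_eqVlt => /predU1P[<-|t0].
  by rewrite powR0 ?mulr0 ?growth0 ?lexx// gt_eqF.
have tp : 0 < t `^ p by exact: powR_gt0.
have [t1|/ltW t1] := leP 1 t; apply/andP; split.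
- apply: (@le_trans _ _ (Phi 1 / C' * t `^ p)).
    by rewrite ler_wpM2r ?(ltW tp)// ge_min lexx orbT.
  have := C'Phi t t t1 t1; rewrite divff ?gt_eqF// ler_pdivlMr// => h.
  by rewrite mulrAC ler_pdivrMr// [leRHS]mulrC.
- apply: (@le_trans _ _ (C * Phi 1 * t `^ p)).
    by have := CPhi 1 t ltr01 t1; rewrite mul1r mulrAC.
  by rewrite ler_wpM2r ?(ltW tp)// le_max lexx.
- apply: (@le_trans _ _ (Phi 1 / C * t `^ p)).
    by rewrite ler_wpM2r ?(ltW tp)// ge_min lexx.
  have tV : 1 <= t^-1 by rewrite invf_ge1.
  have := CPhi t t^-1 t0 tV; rewrite divff ?gt_eqF// (powRV _ t0) => h.
  rewrite mulrAC ler_pdivrMr//; apply: le_trans (ler_wpM2r (ltW tp) h) _.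
  by rewrite le_eqVlt; apply/orP; left; apply/eqP; field; rewrite gt_eqF.
- apply: (@le_trans _ _ (C' * Phi 1 * t `^ p)); last first.
    by rewrite ler_wpM2r ?(ltW tp)// le_max lexx orbT.
  have tV : 1 <= t^-1 by rewrite invf_ge1.
  by have := C'Phi 1 t^-1 (lexx 1) tV; rewrite div1r (powRV _ t0) !invrK.
Qed.

(** Each term of the sum, as a function of [u], has integral [1] over ]0, 1]. *)
Lemma inv_ge_dyadic_sum (u : R) N : 0 < u ->
  \sum_(k < N) 2 ^+ k * (u <= (2 ^+ k)^-1)%R%:R <= 2 * u^-1.
Proof.
move=> u0; elim: N => [|N IH]; first by rewrite big_ord0 mulr_ge0// invr_ge0 ltW.
rewrite big_ord_recr/=; case: (boolP (u <= (2 ^+ N)^-1)) => [uN|_]; last by rewrite mulr0 addr0.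
rewrite mulr1; apply: (@le_trans _ _ (2 * 2 ^+ N)); last first.
  by rewrite ler_pM2l// -[leLHS]invrK lef_pV2 ?posrE ?invr_gt0 ?exprn_gt0//.
have : \sum_(k < N) 2 ^+ k * (u <= (2 ^+ k)^-1)%R%:R <= \sum_(k < N) 2 ^+ k :> R.
  by apply: ler_sum => k _; case: (u <= _); rewrite ?mulr1 ?mulr0 ?lexx ?exprn_ge0.
have geom : \sum_(k < N) 2 ^+ k = 2 ^+ N - 1 :> R.
  by rewrite subrX1 (_ : 2 - 1 = 1) ?mul1r//; lra.
rewrite geom; lra.
Qed.

(** For a function comparable to the identity, the integrand in the condition
    that defines [nabla2] is at least a multiple of [s^-1], whose integral near
    [0] diverges. *)
Lemma nabla2_gt1 Phi p c0 c1 : nabla2 Phi -> 0 < c0 -> power_like p c0 c1 Phi ->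
  1 <= p -> 1 < p.
Proof.
move=> [gPhi _ _ [C C0 nPhi]] c00 pPhi; rewrite le_eqVlt => /predU1P[pE|//].
exfalso; subst p.
have := nPhi 1 ltr01; rewrite divr1; set D := [set` _] => CPhi.
pose I (k : nat) : set (measurableTypeR R) := [set` `]-oo, (2 ^+ k)^-1]].
have mI k : measurable (I k) by exact: measurable_itv.
have mD : measurable (D : set (measurableTypeR R)) by exact: measurable_itv.
have II k : nnm (fun s : measurableTypeR R => 2 ^+ k * \1_(I k) s).
  split=> [|s]; last by rewrite mulr_ge0 ?exprn_ge0// indicE ler0n.
  by apply: measurable_funM => //; exact: measurable_indic.
have c02 : 0 <= c0 / 2 by rewrite divr_ge0 ?ltW.
have low N : ((c0 / 2 * N%:R)%:E <= (C * Phi 1)%:E)%E.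
  apply: le_trans CPhi.
  apply: le_trans (_ : (\int[lebesgue_measure]_(s in D)
      (c0 / 2 * \sum_(k < N) 2 ^+ k * \1_(I k) s)%:E <= _)%E); last first.
    apply: le_integral_any => s; rewrite /D/= in_itv/= => /andP[s0 s1].
      by rewrite lee_fin divr_ge0 ?exprn_ge0 ?(ltW s0)// growth_ge0// ltW.
    rewrite lee_fin; apply: (@le_trans _ _ (c0 / s)).
      rewrite -mulrA ler_pM2l// ler_pdivrMl//.
      apply: le_trans (inv_ge_dyadic_sum N s0); apply: ler_sum => k _.
      rewrite indicE; have [sI|_] := boolP (s \in I k); last first.
        by rewrite mulr0 mulr_ge0// exprn_ge0.
      by move: sI; rewrite inE /I/= in_itv/= => ->.
    have /andP[h _] := pPhi s (ltW s0); rewrite powRr1 ?(ltW s0)// in h.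
    rewrite ler_pdivrMr// expr2 invfM mulrA mulfVK ?gt_eqF//.
    by rewrite ler_pdivlMr.
  rewrite integral_nnmZ//; last by nnm.
  rewrite integral_nnm_sum//.
  rewrite (eq_bigr (fun=> 1%E)); last first.
    move=> k _; rewrite integral_nnmZ; [|exact: mD|by rewrite exprn_ge0|]; last first.
      by split=> [|s]; [exact: measurable_indic|rewrite indicE ler0n].
    rewrite integral_indic//.
    rewrite (_ : I k `&` D = [set` `]0, (2 ^+ k)^-1]]); last first.
      apply/seteqP; split=> s /=; rewrite /I /D/= !in_itv/=.
        by move=> [-> /andP[-> _]].
      move=> /andP[-> h]; split=> //; apply: le_trans h _.
      by rewrite invf_le1 ?exprn_gt0// exprn_ege1// ler1n.
    rewrite [X in (_ * X)%E]lebesgue_measure_itv/= lte_fin invr_gt0 exprn_gt0// sube0 -EFinM.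
    by rewrite divff// expf_neq0.
  by rewrite sumEFin sumr_const card_ord -EFinM.
have := low (Num.truncn (C * Phi 1 / (c0 / 2))).+1.
rewrite lee_fin mulrC -ler_pdivlMr ?divr_gt0// leNgt.
by rewrite truncnS_gt.
Qed.

(** Near [0] a ratio of powers with [r < p] would be unbounded. *)
Lemma power_like_le_exponent Phi Psi p r c0 c1 b0 b1 :
  power_like p c0 c1 Phi -> power_like r b0 b1 Psi -> 0 < c0 -> 0 < c1 -> 0 < b0 ->
  {in `]0, +oo[ &, {homo (fun t => Psi t / Phi t) : s t / s <= t}} -> p <= r.
Proof.
move=> pPhi rPsi c00 c10 b00 ratio; rewrite leNgt; apply/negP => rp.
set e := p - r; have e0 : 0 < e by rewrite subr_gt0.
set X := Psi 1 / Phi 1 * c1 / b0.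
have P1 : 0 < Phi 1.
  by apply: lt_le_trans (_ : c0 * 1 `^ p <= _); rewrite ?powR1 ?mulr1//;
    have /andP[h _] := pPhi 1 ler01; rewrite powR1 mulr1 in h.
have Q1 : 0 <= Psi 1.
  have /andP[h _] := rPsi 1 ler01; apply: le_trans h.
  by rewrite mulr_ge0 ?powR_ge0// ltW.
have X0 : 0 <= X by rewrite !mulr_ge0 ?invr_ge0// ltW.
(* at this point [t] the ratio of the two powers exceeds its bound [X] *)
pose t := (X + 1) `^ (- e^-1).
have t0 : 0 < t by rewrite powR_gt0//; lra.
have t1 : t <= 1.
  rewrite /t powRN invf_le1 ?powR_gt0//; last by lra.
  have : 1 `^ e^-1 <= (X + 1) `^ e^-1.
    by rewrite ge0_ler_powR ?nnegrE ?invr_ge0 ?(ltW e0)//; lra.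
  by rewrite powR1.
have te : t `^ (- e) = X + 1.
  by rewrite /t -powRrM mulrNN mulVf ?gt_eqF// powRr1//; lra.
have tp : 0 < t `^ p by exact: powR_gt0.
have trE : t `^ r = t `^ p * (X + 1).
  rewrite -te -powRD; first by congr (_ `^ _); rewrite /e; lra.
  by rewrite (gt_eqF t0) implybT.
have := ratio t 1; rewrite !in_itv/= !andbT t0 ltr01 => /(_ isT isT t1).
have /andP[_ h1] := pPhi t (ltW t0); have /andP[h2 _] := rPsi t (ltW t0).
have Pt : 0 < Phi t.
  have /andP[h _] := pPhi t (ltW t0); apply: lt_le_trans h; exact: mulr_gt0.
rewrite ler_pdivrMr// => h3.
have : b0 * (X + 1) <= Psi 1 / Phi 1 * c1.
  rewrite -(ler_pM2r tp) (_ : b0 * (X + 1) * _ = b0 * t `^ r); last by rewrite trE; ring.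
  apply: le_trans h2 _.
  by apply: le_trans h3 _; rewrite -[leRHS]mulrA ler_wpM2l// divr_ge0// ltW.
by rewrite -ler_pdivlMl// [leRHS]mulrC -/X; lra.
Qed.

End Growth.

(** * Weights and Luxemburg norms *)

Section WeightFacts.
Variables (R : realType) (d : nat).
Local Notation Rd := (Rd R d).
Implicit Types (w : Rd -> R) (Phi : R -> R).

Lemma weight_nnm w : weight w -> nnm (fun x => `|w x|).
Proof.
by move=> [mw _ _]; split=> [|x]; [exact: measurableT_comp|exact: normr_ge0].
Qed.

(** A weight is only almost everywhere positive; replacing it by its absolute
    value changes no integral. *)
Lemma integral_weight_abs w (D : set Rd) (g : Rd -> R) : weight w ->
  measurable D -> measurable_fun setT g ->
  (\int[leb]_(x in D) (g x * w x)%:E = \int[leb]_(x in D) (g x * `|w x|)%:E)%E.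
Proof.
move=> ww mD mg; have [mw' _] := weight_nnm ww; have [mw _ w0] := ww.
apply: ae_eq_integral; [exact: mD| | |].
- by apply: measurable_funTS; apply/measurable_EFinP; exact: measurable_funM.
- by apply: measurable_funTS; apply/measurable_EFinP; exact: measurable_funM.
by apply: filterS w0 => x wx _; rewrite gtr0_norm.
Qed.

Lemma mass_abs w D : weight w -> measurable D ->
  (mass w D = \int[leb]_(x in D) `|w x|%:E)%E.
Proof.
move=> ww mD; have := @integral_weight_abs w D (fun=> 1) ww mD (measurable_cst _).
by under eq_integral do rewrite mul1r; under [RHS]eq_integral do rewrite mul1r.
Qed.

(** A set of positive measure has positive weight, as the weight vanishes only on
    a null set. *)
Lemma weight_cube w a l : weight w -> 0 < l ->
  (0 < \int[leb]_(x in cube a l) `|w x|%:E < +oo)%E.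
Proof.
move=> ww l0; have [mw iw w0] := ww; have mC := measurable_cube a l.
have mwC : measurable_fun (cube a l) (EFin \o w).
  by apply: measurable_funTS; apply/measurable_EFinP.
apply/andP; split; last first.
  have /integrableP[_] : leb.-integrable (cube a l) (EFin \o w).
    by apply: iw; exists a, l.
  by [].
rewrite lt_neqAle integral_nnm_ge0 ?andbT; last exact: weight_nnm.
apply/eqP => /esym e.
have /(ae_eq_integral_abs leb mC mwC) e0 :
    (\int[leb]_(x in cube a l) `|(EFin \o w) x| = 0)%E by exact: e.
have : leb (cube a l) = 0%E.
  apply: measure_negligible => //.
  have : {ae leb, forall x, ~ cube a l x}.
    apply: (@filterS2 _ _ _ _ _ _ _ e0 w0) => x xe wx xC.
    by have := xe xC => /= -[w0x]; rewrite w0x ltxx in wx.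
  apply: negligibleS => x xC /=; exact.
by rewrite leb_cube// => -[] /eqP; rewrite gt_eqF// exprn_gt0.
Qed.

Lemma mass_cube w a l : weight w -> 0 < l -> (0 < mass w (cube a l) < +oo)%E.
Proof.
by move=> ww l0; rewrite mass_abs//; [exact: weight_cube|exact: measurable_cube].
Qed.

Lemma growth_nnm Phi (F : Rd -> R) : growth Phi -> nnm F -> nnm (Phi \o F).
Proof.
move=> gPhi [mF F0]; split=> [|x]; last exact: growth_ge0.
have mP : measurable (Rplus : set (measurableTypeR R)) by exact: measurable_itv.
apply: (@measurable_comp _ _ _ _ _ _ (Rplus : set (measurableTypeR R)) Phi) => //.
  by move=> _ [x _ <-]; rewrite /Rplus/= in_itv/= F0.
by apply: subspace_continuous_measurable_fun => //; case: gPhi.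
Qed.

Lemma cabsE (z : R[i]) : cabs z = Num.sqrt (complex.Re z ^+ 2 + complex.Im z ^+ 2).
Proof. by case: z. Qed.

Lemma cabs_nnm (f : Rd -> R[i]) : cmeasurable f -> nnm (fun x => cabs (f x)).
Proof.
move=> [mr mi]; split=> [|x]; last by rewrite cabsE sqrtr_ge0.
rewrite (_ : (fun x => _) = (fun x =>
    (complex.Re (f x) ^+ 2 + complex.Im (f x) ^+ 2) `^ 2^-1)); last first.
  by apply/funext => x; rewrite cabsE powR12_sqrt// addr_ge0// sqr_ge0.
apply: (measurableT_comp (measurable_powR _)).
by apply: measurable_funD; exact: measurable_funX.
Qed.

Lemma cabs_scale (s : R) (z : R[i]) : cabs (s%:C * z) = `|s| * cabs z.
Proof.
rewrite !cabsE; case: z => x y /=.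
by rewrite !mul0r subr0 addr0 !exprMn -mulrDr sqrtrM ?sqr_ge0// sqrtr_sqr.
Qed.

Lemma cabs_real (s : R) : cabs s%:C = `|s|.
Proof. by rewrite cabsE/= expr0n addr0 sqrtr_sqr. Qed.

Lemma modular_le Phi w (f : Rd -> R[i]) p c0 c1 (l : R) :
  growth Phi -> power_like p c0 c1 Phi -> 0 < c0 -> weight w -> cmeasurable f ->
  0 < l ->
  (\int[leb]_x (er_map Phi (`|(cabs (f x))%:E| * l^-1%:E) * (w x)%:E) <= 1)%E ->
  (\int[leb]_x ((cabs (f x) / l) `^ p * `|w x|)%:E <= c0^-1%:E)%E.
Proof.
move=> gPhi pPhi c00 ww mf l0 mod1; have wn := weight_nnm ww.
have FF : nnm (fun x => cabs (f x) / l).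
  have cc := cabs_nnm mf; have il : 0 <= l^-1 by rewrite invr_ge0 ltW.
  by nnm.
have PF := growth_nnm gPhi FF.
have : (\int[leb]_x ((Phi \o (fun x => cabs (f x) / l)) x * `|w x|)%:E <= 1)%E.
  rewrite -integral_weight_abs; [|exact: ww|exact: measurableT|by case: PF].
  apply: le_trans mod1; rewrite le_eqVlt; apply/orP; left; apply/eqP.
  apply: eq_integral => x _ /=; rewrite ger0_norm ?EFinM//.
  by case: (cabs_nnm mf).
have ic0 : 0 <= c0^-1 by rewrite invr_ge0 ltW.
have PW := nnmM PF wn; move=> h.
apply: (@le_trans _ _ (\int[leb]_x (c0^-1 *
    ((Phi \o (fun x => cabs (f x) / l)) x * `|w x|))%:E)%E).
  apply: le_integral_nnm; [exact: measurableT|nnm|nnm|move=> x _].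
  rewrite mulrA ler_wpM2r// ler_pdivlMl//=.
  by have [_ F0] := FF; have /andP[] := pPhi _ (F0 x).
rewrite integral_nnmZ; [|exact: measurableT|exact: ic0|exact: PW].
by rewrite -[leRHS]mule1 lee_wpmul2l// lee_fin.
Qed.

End WeightFacts.

(** * The A-infinity constant and the testing condition *)

Section AinftyFacts.
Variables (R : realType) (d : nat).
Local Notation Rd := (Rd R d).
Variable w : Rd -> R.
Hypothesis ww : weight w.

(** The cube [cube a l] competes in the supremum; its half-open part lies in [Q]
    and carries its whole mass. *)
Lemma maximal_ge (Q : set Rd) y a l : measurable Q -> 0 < l ->
  hcube a l `<=` (Q : set (d.-tuple _)) -> cube a l y ->
  ((mean (fun x => `|w x|) a l)%:E
   <= maximal (fun z => (w z * \1_Q z)%:C) y)%E.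
Proof.
move=> mQ l0 sQ ya; have wn := weight_nnm ww.
apply: (@le_trans _ _ ((\1_(cube a l) y / vol (cube a l))%:E *
    \int[leb]_(z in cube a l) (cabs (w z * \1_Q z)%:C)%:E)%E); last first.
  by apply: ereal_sup_ubound; exists (cube a l) => //; exists a, l.
rewrite vol_cube// indicE mem_set// mul1r.
have iQ : nnm (fun z => \1_Q z : R).
  by split=> [|z]; [exact: measurable_indic|rewrite indicE ler0n].
have wQ := nnmM wn iQ.
have /andP[_ wfin] := weight_cube a ww l0.
have Wf : (\int[leb]_(z in cube a l) `|w z|%:E)%E \is a fin_num.
  by rewrite ge0_fin_numE; [exact: wfin|exact: integral_nnm_ge0].
rewrite /mean mulrC EFinM (fineK Wf) lee_wpmul2l//.
  by rewrite lee_fin invr_ge0 exprn_ge0// ltW.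
rewrite le_eqVlt; apply/orP; left; apply/eqP.
under [RHS]eq_integral do rewrite cabs_real normrM [`|\1_Q _|]ger0_norm ?(iQ.2)//.
rewrite -(integral_hcube _ l0 wn) -(integral_hcube _ l0 wQ).
apply: eq_integral => z; rewrite inE => zh.
by rewrite indicE mem_set ?mulr1//; exact: sQ.
Qed.

Lemma mean_cubeE a l : 0 < l ->
  ((mean (fun x => `|w x|) a l * l ^+ d)%:E = mass w (cube a l))%E.
Proof.
move=> l0; rewrite mass_abs//; last exact: measurable_cube.
have /andP[_ wfin] := weight_cube a ww l0.
rewrite /mean mulfVK ?fineK//; last by rewrite expf_neq0// gt_eqF.
rewrite ge0_fin_numE; first exact: wfin.
exact/integral_nnm_ge0/weight_nnm.
Qed.

(** On the unit cube the maximal function is at least the average of [w]. *)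
Lemma Ainfty_const_ge1 : (1 <= Ainfty_const w)%E.
Proof.
pose a : d.-tuple R := nseq_tuple d 0; pose Q := cube a 1.
have mQ : measurable Q by exact: measurable_cube.
have /andP[m0 mfin] := mass_cube a ww ltr01.
have mf : mass w Q \is a fin_num by rewrite ge0_fin_numE// ltW.
have M0 : 0 < fine (mass w Q) by rewrite fine_gt0// m0.
apply: (@le_trans _ _ ((fine (mass w Q))^-1%:E *
   \int[leb]_(x in Q) maximal (fun y => (w y * \1_Q y)%:C) x)%E); last first.
  by apply: ereal_sup_ubound; exists Q => //; exists a, 1.
rewrite (lee_pdivlMl _ _ M0) mule1 (fineK mf).
apply: (@le_trans _ _ (\int[leb]_(x in Q) (mean (fun x => `|w x|) a 1)%:E)%E).
  by rewrite (integral_cst_cube _ _ ltr01) (mean_cubeE a ltr01) lexx.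
have mean0 : 0 <= mean (fun x => `|w x|) a 1.
  exact: mean_ge0 ltr01 (weight_nnm ww).
have mg x : Q x -> ((mean (fun x => `|w x|) a 1)%:E
    <= maximal (fun y => (w y * \1_Q y)%:C) x)%E.
  by move=> Qx; exact: (maximal_ge mQ ltr01 (@hcube_sub_cube _ _ a 1) Qx).
apply: le_integral_any => [x Qx|x Qx]; last exact: mg.
by apply: le_trans (mg x Qx); rewrite lee_fin.
Qed.

(** The hypothesis of [principal_carleson] on [s], for a closed cube. *)
Lemma Ainfty_integral_le K a l (h : Rd -> R) :
  Ainfty_const w = K%:E -> 0 < l -> nnm h ->
  (forall y, cube a l y -> h y = 0 \/
    exists a' l', [/\ 0 < l', hcube a' l' `<=` (cube a l : set (d.-tuple _)),
      cube a' l' y & h y = mean (fun x => `|w x|) a' l']) ->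
  (\int[leb]_(y in cube a l) (h y)%:E
   <= K%:E * \int[leb]_(y in cube a l) `|w y|%:E)%E.
Proof.
move=> KE l0 hh hP; have mQ : measurable (cube a l) by exact: measurable_cube.
pose M := maximal (fun y => (w y * \1_(cube a l) y)%:C).
have /andP[m0 mfin] := mass_cube a ww l0.
have mf : mass w (cube a l) \is a fin_num by rewrite ge0_fin_numE// ltW.
have M0 : 0 < fine (mass w (cube a l)) by rewrite fine_gt0// m0.
have Mge0 x : cube a l x -> (0 <= M x)%E.
  move=> xa; apply: (@le_trans _ _ (mean (fun x => `|w x|) a l)%:E).
    by rewrite lee_fin; exact: mean_ge0 l0 (weight_nnm ww).
  exact: (maximal_ge mQ l0 (@hcube_sub_cube _ _ a l) xa).
apply: (@le_trans _ _ (\int[leb]_(y in cube a l) M y)%E).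
  apply: le_integral_any; first exact: Mge0.
  move=> y ya; case: (hP y ya) => [->|]; first exact: Mge0.
  by move=> [a' [l' [l'0 sub y' ->]]]; exact: maximal_ge mQ l'0 sub y'.
rewrite -(mass_abs ww mQ) -(fineK mf) muleC -(lee_pdivrMl _ _ M0) -KE.
by apply: ereal_sup_ubound; exists (cube a l) => //; exists a, l.
Qed.

End AinftyFacts.

(** With [t i = avg i / y i <= kap i], all factors of the product but one are
    bounded trivially; the remaining one enters with the smaller power [p]. *)
Lemma testing_algebra (R : realType) n (i0 : 'I_n) (E avg y kap : 'I_n -> R)
    (A b p r c1 s0 W : R) :
  (forall i, 0 <= E i) -> (forall i, 0 <= avg i) -> (forall i, 0 < y i) ->
  (forall i, 0 < kap i) -> (forall i, avg i <= kap i * y i) ->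
  1 < p -> p <= r -> 0 < b -> 0 <= W -> 0 < s0 -> s0^-1 <= c1 * y i0 `^ p ->
  W * (b * (\prod_i E i) `^ r) * (b * (\prod_i y i) `^ r) <= A ->
  (\prod_i E i * \prod_i avg i) `^ r * W
  <= A * (b ^- 2 * (\prod_i kap i) `^ r * kap i0 `^ (- p) * c1) * avg i0 `^ p * s0.
Proof.
move=> E0 avg0 y0 k0 avgle p1 pr b0 W0 s00 s0y HA.
have r0 : 0 < r by lra.
have PE : 0 <= \prod_i E i by exact: prodr_ge0.
have Py : 0 < \prod_i y i by exact: prodr_gt0.
have Pk : 0 < \prod_i kap i by exact: prodr_gt0.
have Pa : 0 <= \prod_i avg i by exact: prodr_ge0.
pose t i := avg i / y i; pose u := t i0 / kap i0.
have t0 i : 0 <= t i by rewrite divr_ge0// ltW.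
have tk i : t i <= kap i by rewrite ler_pdivrMr.
have u0 : 0 <= u by rewrite divr_ge0// ltW.
have u1 : u <= 1 by rewrite ler_pdivrMr// mul1r.
have Pt : 0 <= \prod_i t i by exact: prodr_ge0.
have avgE : \prod_i avg i = \prod_i y i * \prod_i t i.
  by rewrite -big_split/=; apply: eq_bigr => i _; rewrite mulrCA divff ?mulr1// gt_eqF.
have tle : \prod_i t i <= \prod_i kap i * u.
  rewrite (bigD1 i0)//= [X in _ <= X * _](bigD1 i0)//=.
  rewrite (_ : kap i0 * _ * u = t i0 * \prod_(i < n | i != i0) kap i); last first.
    by rewrite /u; field; rewrite gt_eqF.
  by rewrite ler_wpM2l//; apply: ler_prod => i _; rewrite t0 tk.
have ur : u `^ r <= u `^ p.
  move: u0; rewrite le_eqVlt => /predU1P[<-|u0']; last by rewrite ger_powR ?u0'.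
  by rewrite !powR0// gt_eqF//; lra.
have tr : (\prod_i t i) `^ r <= (\prod_i kap i) `^ r * u `^ p.
  apply: (@le_trans _ _ ((\prod_i kap i * u) `^ r)).
    have Pku : 0 <= \prod_i kap i * u by rewrite mulr_ge0// ltW.
    by apply: ge0_ler_powR; rewrite ?nnegrE//; exact: ltW.
  by rewrite powRM ?(ltW Pk)// ler_wpM2l ?powR_ge0.
have up : u `^ p <= kap i0 `^ (- p) * c1 * avg i0 `^ p * s0.
  rewrite /u /t !powRM ?invr_ge0 ?(ltW (y0 _)) ?(ltW (k0 _)) ?mulr_ge0 ?invr_ge0 ?(ltW (y0 _))//.
  rewrite !powRV// powRN.
  have yp : 0 < y i0 `^ p by exact: powR_gt0.
  have h : (y i0 `^ p)^-1 <= c1 * s0.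
    rewrite -[leLHS]mul1r ler_pdivrMr// mulrAC -ler_pdivrMr// div1r.
    by rewrite mulrC in s0y *.
  rewrite (_ : _ * c1 * _ * s0 = (avg i0 `^ p * (kap i0 `^ p)^-1) * (c1 * s0)); last by ring.
  rewrite mulrAC ler_wpM2l// mulr_ge0 ?powR_ge0// invr_ge0 powR_ge0//.
have HA' : (\prod_i E i) `^ r * (\prod_i y i) `^ r * W <= A * b ^- 2.
  rewrite ler_pdivlMr ?exprn_gt0//; apply: le_trans HA.
  by rewrite le_eqVlt; apply/orP; left; apply/eqP; ring.
have A0 : 0 <= A.
  by apply: le_trans HA; rewrite !mulr_ge0 ?powR_ge0// ltW.
rewrite avgE mulrA powRM ?mulr_ge0 ?(ltW Py)// powRM ?(ltW Py)// mulrAC.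
apply: (@le_trans _ _ (A * b ^- 2 * (\prod_i t i) `^ r)).
  by rewrite ler_wpM2r ?powR_ge0.
rewrite (_ : A * _ * _ * s0 = A * b ^- 2 *
    ((\prod_i kap i) `^ r * (kap i0 `^ (- p) * c1 * avg i0 `^ p * s0))); last by ring.
rewrite ler_wpM2l ?mulr_ge0 ?invr_ge0 ?exprn_ge0 ?(ltW b0)//.
by apply: le_trans tr _; rewrite ler_wpM2l ?powR_ge0.
Qed.

Section Testing.
Variables (R : realType) (n d : nat) (alpha : R).
Local Notation Rd := (Rd R d).
Variables (Phis : 'I_n -> R -> R) (Psi : R -> R) (i0 : 'I_n).
Variables (sigma : 'I_n -> Rd -> R) (omega : Rd -> R) (F : 'I_n -> Rd -> R).
Variables (p c0 c1 : 'I_n -> R) (r b0 b1 A : R).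
Hypothesis nd0 : (0 < n * d)%N.
Hypothesis sw : forall i, weight (sigma i).
Hypothesis ow : weight omega.
Hypothesis FF : forall i, nnm (F i).
Hypothesis gPhi : forall i, growth (Phis i).
Hypothesis gPsi : growth Psi.
Hypothesis p1 : forall i, 1 < p i.
Hypothesis pr : p i0 <= r.
Hypothesis c00 : forall i, 0 < c0 i.
Hypothesis c10 : forall i, 0 < c1 i.
Hypothesis b00 : 0 < b0.
Hypothesis pPhi : forall i, power_like (p i) (c0 i) (c1 i) (Phis i).
Hypothesis rPsi : power_like r b0 b1 Psi.
Hypothesis Fp : forall i,
  (\int[leb]_x (F i x `^ p i * `|sigma i x|)%:E <= (c0 i)^-1%:E)%E.
Hypothesis AE : A_const alpha Phis Psi sigma omega = A%:E.

Let S i x := `|sigma i x|.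
Let SS i : nnm (S i). Proof. exact: weight_nnm. Qed.
Let FS i : nnm (fun y => F i y * S i y). Proof. exact: nnmM. Qed.

Definition kappa i : R := (c1 i / c0 i) `^ (p i)^-1.

Lemma kappa_gt0 i : 0 < kappa i.
Proof. by rewrite powR_gt0// divr_gt0. Qed.

Let p0 i : 0 < p i. Proof. by have := p1 i; lra. Qed.

Lemma kappaE i : kappa i `^ p i = c1 i / c0 i.
Proof.
by rewrite /kappa -powRrM mulVf ?gt_eqF// powRr1// divr_ge0// ltW.
Qed.

(** Locally, a function is at most [1] plus its [p]-th power. *)
Lemma integral_FS_fin i a l : 0 < l ->
  (\int[leb]_(y in cube a l) (F i y * S i y)%:E < +oo)%E.
Proof.
move=> l0; have mQ := measurable_cube a l.
have Fpn : nnm (fun y => F i y `^ p i * S i y).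
  by have := FF i; have := SS i; nnm.
apply: (@le_lt_trans _ _
    (\int[leb]_(y in cube a l) (S i y + F i y `^ p i * S i y)%:E)%E).
  apply: le_integral_nnm; [exact: mQ|exact: FS|by apply: nnmD|move=> y _].
  have s0 : 0 <= S i y by case: (SS i).
  have f0 : 0 <= F i y by case: (FF i).
  rewrite -[X in X + _]mul1r -mulrDl ler_wpM2r//.
  have [f1|/ltW f1] := leP 1 (F i y); last by rewrite ler_wpDr ?powR_ge0.
  apply: ler_wpDl => //; rewrite -[leLHS]powRr1// ler_powR//; exact/ltW.
rewrite integral_nnmD; [|exact: mQ|exact: SS|exact: Fpn].
apply: lte_add_pinfty; first by have /andP[] := weight_cube a (sw i) l0.
apply: (@le_lt_trans _ _ (c0 i)^-1%:E); last exact: ltry.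
apply: le_trans (Fp i).
exact: (subset_integral_nnm leb mQ measurableT Fpn (@subsetT _ _)).
Qed.

(** Jensen's inequality and the normalization [Fp] bound the average of [F i] over
    the cube by a multiple of [ginv (Phis i)] at the inverse of the mass of
    [sigma i], which is the argument of [Psi] in [A_const]. *)
Lemma testing_condition a l : 0 < l ->
  ((multi_mean alpha F S a l `^ r)%:E * \int[leb]_(y in cube a l) `|omega y|%:E
  <= (A * (b0 ^- 2 * (\prod_i kappa i) `^ r * c0 i0)
      * (fine (\int[leb]_(y in cube a l) (F i0 y * S i0 y)%:E)
           / fine (\int[leb]_(y in cube a l) (S i0 y)%:E)) `^ p i0)%:E
     * \int[leb]_(y in cube a l) (S i0 y)%:E)%E.
Proof.
move=> l0; have mQ := measurable_cube a l.
have Sfin i : (\int[leb]_(y in cube a l) (S i y)%:E)%E \is a fin_num.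
  have /andP[_ sfin] := weight_cube a (sw i) l0.
  by rewrite ge0_fin_numE; [exact: sfin|exact: integral_nnm_ge0].
have Ofin : (\int[leb]_(y in cube a l) `|omega y|%:E)%E \is a fin_num.
  have /andP[_ ofin] := weight_cube a ow l0.
  by rewrite ge0_fin_numE; [exact: ofin|exact/integral_nnm_ge0/weight_nnm].
pose m i := fine (\int[leb]_(y in cube a l) (S i y)%:E).
have mE i : (\int[leb]_(y in cube a l) (S i y)%:E)%E = (m i)%:E by rewrite fineK.
have massE i : mass (sigma i) (cube a l) = (m i)%:E.
  by rewrite -mE; exact: mass_abs.
have m0 i : 0 < m i.
  by have /andP[] := mass_cube a (sw i) l0; rewrite massE lte_fin.
pose W := fine (\int[leb]_(y in cube a l) `|omega y|%:E).
have WE : (\int[leb]_(y in cube a l) `|omega y|%:E)%E = W%:E by rewrite fineK.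
have W0 : 0 <= W by rewrite fine_ge0//; exact/integral_nnm_ge0/weight_nnm.
pose av i := fine (\int[leb]_(y in cube a l) (F i y * S i y)%:E) / m i.
have av0 i : 0 <= av i.
  by rewrite divr_ge0 ?(ltW (m0 i))// fine_ge0//; exact/integral_nnm_ge0/FS.
pose y i := ginv (Phis i) (m i)^-1.
have im0 i : 0 <= (m i)^-1 by rewrite invr_ge0 ltW.
have yge0 i : 0 <= y i by exact: ginv_ge0.
have Py i : Phis i (y i) = (m i)^-1 by exact: ginvK.
have my i : (m i)^-1 <= c1 i * y i `^ p i.
  by have /andP[_] := pPhi i (yge0 i); rewrite Py.
have y0 i : 0 < y i.
  rewrite lt_neqAle yge0 andbT; apply/eqP => e.
  by have := my i; rewrite -e powR0 ?gt_eqF// mulr0 leNgt invr_gt0 m0.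
have avy i : av i <= kappa i * y i.
  have J : (av i) `^ p i * m i <= (c0 i)^-1.
    have := @jensen_powR _ _ _ leb _ _ _ _ mQ (FF i) (SS i) (p1 i)
      (weight_cube a (sw i) l0) (integral_FS_fin i a l0).
    rewrite mE -EFinM => /le_trans jensen; rewrite -lee_fin; apply: jensen.
    apply: le_trans (Fp i).
    have Fpn := nnmM (nnm_powR (p i) (FF i)) (SS i).
    exact: (subset_integral_nnm leb mQ measurableT Fpn (@subsetT _ _)).
  rewrite leNgt; apply/negP => lt_av.
  have : (kappa i * y i) `^ p i < av i `^ p i.
    have ky0 : 0 <= kappa i * y i by rewrite mulr_ge0// ltW// kappa_gt0.
    by apply: gt0_ltr_powR; rewrite ?nnegrE.
  rewrite powRM ?(ltW (kappa_gt0 i))// kappaE ltNge => /negP; apply.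
  rewrite -(ler_pM2r (m0 i)); apply: le_trans J _.
  have h := my i; rewrite -[leLHS]mulr1.
  rewrite (_ : _ * _ * m i = (c0 i)^-1 * (c1 i * y i `^ p i * m i)); last by ring.
  by rewrite ler_pM2l ?invr_gt0// -ler_pdivrMr// div1r.
pose V : R := l ^+ d; have V0 : 0 < V by rewrite exprn_gt0.
pose E i := m i / V `^ (1 - alpha / (n * d)%:R).
have E0 i : 0 <= E i by rewrite divr_ge0 ?powR_ge0// ltW.
have HA : W * (b0 * (\prod_i E i) `^ r) * (b0 * (\prod_i y i) `^ r) <= A.
  rewrite -lee_fin -AE; apply: (@le_trans _ _ (mass omega (cube a l) *
      (Psi (\prod_(i < n) (fine (mass (sigma i) (cube a l)) /
         vol (cube a l) `^ (1 - alpha / (n * d)%:R)))%R)%:E *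
      (Psi (\prod_(i < n) ginv (Phis i) (fine (mass (sigma i) (cube a l)))^-1)%R)%:E)%E);
    last by apply: ereal_sup_ubound; exists (cube a l) => //; exists a, l.
  rewrite mass_abs// WE vol_cube// -!EFinM lee_fin.
  under [X in _ <= _ * Psi X * _]eq_bigr do rewrite massE.
  under [X in _ <= _ * _ * Psi X]eq_bigr do rewrite massE.
  have PE : 0 <= \prod_i E i by exact: prodr_ge0.
  have Pyy : 0 <= \prod_i y i by exact: prodr_ge0.
  have /andP[h1 _] := rPsi PE; have /andP[h2 _] := rPsi Pyy.
  apply: ler_pM => //; rewrite ?mulr_ge0 ?powR_ge0 ?(ltW b00)//.
  exact: ler_wpM2l.
have mmE : multi_mean alpha F S a l = \prod_i E i * \prod_i av i.
  rewrite -big_split/= /multi_mean -/V.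
  have n0 : n%:R != 0 :> R by rewrite pnatr_eq0; case: n i0 => [[]|].
  have d0 : d%:R != 0 :> R.
    by rewrite pnatr_eq0; apply/eqP => e; move: nd0; rewrite e muln0.
  have -> : V `^ (alpha / d%:R) = \prod_(i < n) V `^ (alpha / (n * d)%:R).
    rewrite prodr_const card_ord -powR_mulrn ?powR_ge0// -powRrM natrM.
    by congr (_ `^ _); field; rewrite n0 d0.
  rewrite -big_split/=; apply: eq_bigr => i _.
  rewrite /E /av /mean -/V powRD; last by rewrite (gt_eqF V0) implybT.
  rewrite powRr1 ?(ltW V0)// powRN.
  have Vg : V `^ (alpha / (n * d)%:R) != 0 by rewrite gt_eqF ?powR_gt0.
  by field; rewrite Vg !gt_eqF.
rewrite WE mE mmE -!EFinM lee_fin.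
apply: le_trans (testing_algebra E0 av0 y0 kappa_gt0 avy (p1 i0) pr b00 W0 (m0 i0) (my i0) HA) _.
rewrite powRN kappaE invf_div (_ : b0 ^- 2 * _ * _ * c1 i0 = b0 ^- 2 * (\prod_i kappa i) `^ r * c0 i0)//.
by field; rewrite !gt_eqF.
Qed.

End Testing.

(** * The weighted inequality *)

Section Pointwise.
Variables (R : realType) (n d : nat) (alpha : R).
Local Notation Rd := (Rd R d).
Variables (i0 : 'I_n) (sigma : 'I_n -> Rd -> R) (f : 'I_n -> Rd -> R[i]).
Variables (lam : 'I_n -> R) (omega : Rd -> R) (Psi : R -> R) (r b0 b1 : R).
Hypothesis lam0 : forall i, 0 < lam i.
Hypothesis sw : forall i, weight (sigma i).
Hypothesis cf : forall i, cmeasurable (f i).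

Let F i x := cabs (f i x) / lam i.
Let S i x := `|sigma i x|.

Lemma nnm_normalized i : nnm (F i).
Proof.
have cc := cabs_nnm (cf i); have il : 0 <= (lam i)^-1 by rewrite invr_ge0 ltW.
by rewrite /F; nnm.
Qed.

Hypothesis FS_fin : forall i a l, 0 < l ->
  (\int[leb]_(y in cube a l) (F i y * S i y)%:E < +oo)%E.

Local Notation M :=
  (multi_maximal alpha (fun i x => ((sigma i x)%:C * f i x)%R)).

Lemma multi_maximal_ge0 x : (0 <= M x)%E.
Proof.
pose Q : set Rd := cube x 1.
apply: (@le_trans _ _ ((vol Q `^ (alpha / d%:R))%:E *
  \prod_(i < n) ((\1_Q x / vol Q)%:E *
     \int[leb]_(y in Q) (cabs ((sigma i y)%:C * f i y))%:E))%E); last first.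
  by apply: ereal_sup_ubound; exists Q => //; exists x, 1.
rewrite mule_ge0 ?lee_fin ?powR_ge0//; apply: prode_ge0 => i _.
rewrite mule_ge0//.
  by rewrite lee_fin /Q vol_cube// expr1n divr1 indicE ler0n.
by apply: integral_ge0 => y _; rewrite lee_fin cabsE sqrtr_ge0.
Qed.

Lemma multi_maximal_le x u : 0 <= u ->
  (forall a l, 0 < l -> cube a l x -> multi_mean alpha F S a l <= u) ->
  (M x <= (\prod_i lam i * u)%:E)%E.
Proof.
move=> u0 le_u; have L0 : 0 <= \prod_i lam i by apply: prodr_ge0 => i _; exact: ltW.
apply: ge_ereal_sup => _ [_ [a [l [l0 ->]]] <-]; rewrite vol_cube//.
have mQ := measurable_cube a l.
have FSn i : nnm (fun y => F i y * S i y).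
  by apply: nnmM; [exact: nnm_normalized|exact: weight_nnm].
have intE i : (\int[leb]_(y in cube a l) (cabs ((sigma i y)%:C * f i y))%:E =
    (lam i * fine (\int[leb]_(y in cube a l) (F i y * S i y)%:E))%:E)%E.
  rewrite EFinM fineK; last first.
    by rewrite ge0_fin_numE; [exact: FS_fin|exact: integral_nnm_ge0].
  rewrite -(integral_nnmZ leb mQ (ltW (lam0 i)) (FSn i)).
  apply: eq_integral => y _; rewrite cabs_scale /F /S mulrA mulrCA divff ?mulr1 1?mulrC//.
  by rewrite gt_eqF.
rewrite (eq_bigr (fun i => (\1_(cube a l) x / l ^+ d *
    (lam i * fine (\int[leb]_(y in cube a l) (F i y * S i y)%:E)))%:E)); last first.
  by move=> i _; rewrite [RHS]EFinM -intE.
rewrite prodEFin -EFinM lee_fin indicE.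
have [xa|_] := boolP (x \in cube a l); last first.
  by rewrite (bigD1 i0)//= !mul0r mulr0 mulr_ge0.
rewrite inE in xa; apply: le_trans (ler_wpM2l L0 (le_u a l l0 xa)).
rewrite /multi_mean mulrCA -big_split/= le_eqVlt; apply/orP; left; apply/eqP.
by congr (_ * _); apply: eq_bigr => i _; rewrite mul1r /mean mulrCA [(l ^+ d)^-1 * _]mulrC.
Qed.

Hypothesis gPsi : growth Psi.
Hypothesis rPsi : power_like r b0 b1 Psi.
Hypothesis r0 : 0 < r.
Hypothesis b10 : 0 < b1.

(** The bounds on all contributions [multi_mean a l] pass to their supremum, also
    if it is infinite, and where [omega] is not positive the left-hand side is at
    most [0]. *)
Lemma er_map_growth_le x L (h : \bar R) : 0 < L -> (0 <= h)%E ->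
  (forall a l, 0 < l -> cube a l x ->
     ((multi_mean alpha F S a l `^ r * `|omega x|)%:E <= h)%E) ->
  (er_map Psi (`|M x| * L^-1%:E) * (omega x)%:E
   <= (b1 * (\prod_i lam i / L) `^ r)%:E * h)%E.
Proof.
move=> L0 h0 hM; have il : 0 < L^-1 by rewrite invr_gt0.
have lamp : 0 < \prod_i lam i by exact: prodr_gt0.
have kpos : 0 < b1 * (\prod_i lam i / L) `^ r.
  by rewrite mulr_gt0// powR_gt0// divr_gt0.
have Mge := multi_maximal_ge0 x; rewrite gee0_abs//.
have Pge (z : \bar R) : (0 <= z)%E -> (0 <= er_map Psi z)%E.
  by case: z => [z| |]//=; rewrite !lee_fin; exact: growth_ge0.
have ML0 : (0 <= M x * L^-1%:E)%E by rewrite mule_ge0// lee_fin ltW.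
have [w0|w0] := leP (omega x) 0.
  apply: (@le_trans _ _ 0%E); first by rewrite mule_ge0_le0 ?lee_fin ?Pge.
  by rewrite mule_ge0// lee_fin ltW.
case: h h0 hM => [h| |]//.
  rewrite lee_fin => h0 hM; rewrite gtr0_norm// in hM.
  pose u := (h / omega x) `^ r^-1.
  have hw : 0 <= h / omega x by rewrite divr_ge0// ltW.
  have u0 : 0 <= u by exact: powR_ge0.
  have ur : u `^ r = h / omega x by rewrite /u -powRrM mulVf ?powRr1// gt_eqF.
  have Mu : (M x <= (\prod_i lam i * u)%:E)%E.
    apply: multi_maximal_le => // a l l0 xa.
    have := hM a l l0 xa; rewrite lee_fin -ler_pdivlMr// -ur => h1.
    rewrite leNgt; apply/negP => h2; move: h1; rewrite leNgt => /negP; apply.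
    have m0 := le_trans u0 (ltW h2).
    by apply: gt0_ltr_powR; rewrite ?nnegrE.
  case: (M x) Mge Mu {ML0} => [m| |]//; rewrite !lee_fin => m0 mu.
  have lu : 0 <= \prod_i lam i * u / L by rewrite divr_ge0 ?mulr_ge0// ltW.
  have le1 : Psi (m / L) <= b1 * (\prod_i lam i * u / L) `^ r.
    have /andP[_] := rPsi lu; apply: le_trans.
    by apply: growth_homo; rewrite ?divr_ge0 ?ler_wpM2r// ltW.
  apply: le_trans (ler_wpM2r (ltW w0) le1) _.
  rewrite (_ : \prod_i lam i * u / L = (\prod_i lam i / L) * u); last by ring.
  rewrite powRM ?divr_ge0 ?(ltW lamp) ?(ltW L0)// ur.
  by rewrite le_eqVlt; apply/orP; left; apply/eqP; field; rewrite gt_eqF.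
by move=> _ _; rewrite gt0_muley ?lte_fin// leey.
Qed.

End Pointwise.

(** The norms are infima, possibly zero, and need not be admissible; the bound is
    first proved for admissible numbers that exceed them by at most [e]. *)
Lemma le_prod_limit (R : realType) n (nu : 'I_n -> R) (a : R) (x : \bar R) :
  (forall e, 0 < e -> (x <= (a * \prod_i (nu i + e))%:E)%E) ->
  (x <= (a * \prod_i nu i)%:E)%E.
Proof.
case: x => [x| |] H; last by rewrite leNye.
- pose P := a *: \prod_i ((nu i)%:P + 'X) : {poly R}.
  have PE e : P.[e] = a * \prod_i (nu i + e).
    by rewrite hornerZ horner_prod; congr (_ * _); apply: eq_bigr => i _; rewrite !hornerE.
  have <- : P.[0] = a * \prod_i nu i.
    by rewrite PE; congr (_ * _); apply: eq_bigr => i _; rewrite addr0.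
  have cP : (fun k => P.[harmonic k]) @ \oo --> P.[0].
    by apply: continuous_cvg; [exact: continuous_horner|exact: cvg_harmonic].
  rewrite lee_fin; apply: (cvgr_to_ge cP); apply: nearW => k.
  by rewrite PE -lee_fin; exact/H/harmonic_gt0.
- by have := H 1 ltr01.
Qed.

Lemma final_constant (R : realType) (A K k g b0 b1 c c0 C Cp Lam r : R) :
  0 < C -> 0 < g -> 0 < Lam -> 0 < b0 -> 0 < b1 -> 0 < c0 -> 0 < r ->
  C `^ r = b1 ^+ 2 * b0 ^- 2 * c * k * 2 * Cp -> A * K <= b1 * g `^ r ->
  b1 * (Lam / (C * g * Lam)) `^ r
  * (c * (A * (b0 ^- 2 * k * c0) * (2 * K * Cp)) * c0^-1) <= 1.
Proof.
move=> C0 g0 Lam0 b00 b10 c00 r0 CE AK.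
have gr0 : 0 < g `^ r by exact: powR_gt0.
have Cr0 : 0 < C `^ r by exact: powR_gt0.
have -> : (Lam / (C * g * Lam)) `^ r = (C `^ r * g `^ r)^-1.
  rewrite -powRM ?(ltW C0) ?(ltW g0)// -powRV ?mulr_gt0//; congr (_ `^ _).
  by field; rewrite !gt_eqF.
rewrite (_ : b1 * _ * _ =
   (b1 ^+ 2 * b0 ^- 2 * c * k * 2 * Cp) / C `^ r * (A * K / (b1 * g `^ r))); last first.
  by field; rewrite !gt_eqF.
rewrite -CE divff ?gt_eqF// mul1r ler_pdivrMr ?mul1r// mulr_gt0//.
Qed.

Section LuxemburgBound.
Variables (R : realType) (n d : nat) (alpha : R).
Local Notation Rd := (Rd R d).
Variables (Phis : 'I_n -> R -> R) (Psi : R -> R) (i0 : 'I_n).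
Variables (p c0 c1 : 'I_n -> R) (r b0 b1 : R).
Hypothesis nd0 : (0 < n * d)%N.
Hypothesis alpha0 : 0 <= alpha.
Hypothesis gPhi : forall i, growth (Phis i).
Hypothesis gPsi : growth Psi.
Hypothesis p1 : forall i, 1 < p i.
Hypothesis pr : p i0 <= r.
Hypothesis c00 : forall i, 0 < c0 i.
Hypothesis c10 : forall i, 0 < c1 i.
Hypothesis b00 : 0 < b0.
Hypothesis b10 : 0 < b1.
Hypothesis pPhi : forall i, power_like (p i) (c0 i) (c1 i) (Phis i).
Hypothesis rPsi : power_like r b0 b1 Psi.

Let grid_constant : R := (6 ^ (d * n) * (2 * n) ^ n)%:R `^ r * 2 ^+ d.
Let doob_constant : R := 2 `^ p i0 / (p i0 - 1).
Let kap := \prod_i kappa p c0 c1 i.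

(** The root that makes the modular of the quotient at most [1] in
    [final_constant]. *)
Definition lux_constant : R :=
  (b1 ^+ 2 * b0 ^- 2 * grid_constant * kap `^ r * 2 * doob_constant) `^ r^-1.

Let r0 : 0 < r. Proof. exact: lt_le_trans (lt_trans ltr01 (p1 i0)) pr. Qed.

Let n0 : (0 < n)%N. Proof. by case: n i0 => [[]|]. Qed.

Let grid_gt0 : 0 < grid_constant.
Proof.
rewrite mulr_gt0 ?exprn_gt0// powR_gt0// ltr0n muln_gt0 !expn_gt0/=.
by rewrite muln_gt0 n0.
Qed.

Let doob_gt0 : 0 < doob_constant.
Proof. by rewrite divr_gt0 ?powR_gt0// subr_gt0. Qed.

Let kap_gt0 : 0 < kap.
Proof. by apply: prodr_gt0 => i _; exact: kappa_gt0. Qed.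

Let radicand_gt0 :
  0 < b1 ^+ 2 * b0 ^- 2 * grid_constant * kap `^ r * 2 * doob_constant.
Proof.
have kr := powR_gt0 r kap_gt0; have bb : 0 < b1 ^+ 2 by rewrite exprn_gt0.
have ib : 0 < b0 ^- 2 by rewrite invr_gt0 exprn_gt0.
apply: mulr_gt0; last exact: doob_gt0.
 apply: mulr_gt0; last exact: ltr0n.
apply: mulr_gt0; last exact: kr.
by apply: mulr_gt0; [exact: mulr_gt0|exact: grid_gt0].
Qed.

Lemma lux_constant_gt0 : 0 < lux_constant.
Proof. exact: powR_gt0. Qed.

Lemma lux_constantE : lux_constant `^ r =
  b1 ^+ 2 * b0 ^- 2 * grid_constant * kap `^ r * 2 * doob_constant.
Proof. by rewrite /lux_constant -powRrM mulVf ?gt_eqF// powRr1// ltW. Qed.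

Variables (sigma : 'I_n -> Rd -> R) (omega : Rd -> R).
Hypothesis sw : forall i, weight (sigma i).
Hypothesis ow : weight omega.

Lemma A_const_gt0 : (0 < A_const alpha Phis Psi sigma omega)%E.
Proof.
pose Q : set Rd := cube (nseq_tuple d 0) 1.
have mass0 w : weight w -> exists2 m, 0 < m & mass w Q = m%:E.
  move=> ww; have /andP[m0 my] := mass_cube (nseq_tuple d 0) ww ltr01.
  exists (fine (mass w Q)); first by rewrite fine_gt0// m0.
  by rewrite fineK// ge0_fin_numE// ltW.
have [W W0 WE] := mass0 _ ow.
have s0 i : 0 < fine (mass (sigma i) Q).
  by have [m m0 ->] := mass0 _ (sw i).
have Psi_gt0 t : 0 < t -> 0 < Psi t.
  move=> t0; have /andP[h _] := rPsi (ltW t0); apply: lt_le_trans h.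
  by rewrite mulr_gt0// powR_gt0.
apply: (@lt_le_trans _ _ (mass omega Q *
      (Psi (\prod_(i < n) (fine (mass (sigma i) Q) /
         vol Q `^ (1 - alpha / (n * d)%:R)))%R)%:E *
      (Psi (\prod_(i < n) ginv (Phis i) (fine (mass (sigma i) Q))^-1)%R)%:E)%E).
  rewrite WE -!EFinM lte_fin !mulr_gt0// ?Psi_gt0//.
    apply: prodr_gt0 => i _; rewrite divr_gt0// powR_gt0//.
    by rewrite /Q vol_cube// expr1n.
  apply: prodr_gt0 => i _; have im0 : 0 < (fine (mass (sigma i) Q))^-1 by rewrite invr_gt0.
  rewrite lt_neqAle ginv_ge0 ?(ltW im0)// andbT; apply/eqP => e.
  by have := ginvK (gPhi i) (ltW im0); rewrite -e growth0// => e'; rewrite -e' ltxx in im0.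
by apply: ereal_sup_ubound; exists Q => //; exists (nseq_tuple d 0), 1.
Qed.

Variables (A K g : R) (f : 'I_n -> Rd -> R[i]) (lam : 'I_n -> R).
Hypothesis AE : A_const alpha Phis Psi sigma omega = A%:E.
Hypothesis KE : Ainfty_const (sigma i0) = K%:E.
Hypothesis g0 : 0 < g.
Hypothesis AK : A * K <= b1 * g `^ r.
Hypothesis cf : forall i, cmeasurable (f i).
Hypothesis lam0 : forall i, 0 < lam i.
Hypothesis admissible : forall i,
  (\int[leb]_x (er_map (Phis i) (`|(cabs (f i x))%:E| * (lam i)^-1%:E)
     * (sigma i x)%:E) <= 1)%E.

Lemma lux_maximal_le :
  (lux Psi omega (multi_maximal alpha (fun i x => ((sigma i x)%:C * f i x)%R))
   <= (lux_constant * g * \prod_i lam i)%:E)%E.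
Proof.
pose F i x := cabs (f i x) / lam i; pose S i x := `|sigma i x|.
have FF i : nnm (F i) by exact: nnm_normalized.
have SS i : nnm (S i) by exact: weight_nnm.
have Fp i : (\int[leb]_x (F i x `^ p i * S i x)%:E <= (c0 i)^-1%:E)%E.
  exact: (modular_le (gPhi i) (pPhi i)).
have FSfin i a l : 0 < l -> (\int[leb]_(y in cube a l) (F i y * S i y)%:E < +oo)%E.
  exact: (integral_FS_fin sw FF p1 Fp).
have A0 : 0 < A by rewrite -lte_fin -AE A_const_gt0.
have K1 : 1 <= K by rewrite -lee_fin -KE; exact: Ainfty_const_ge1.
pose B := A * (b0 ^- 2 * kap `^ r * c0 i0).
have B0 : 0 <= B.
  by rewrite !mulr_ge0 ?powR_ge0 ?(ltW (c00 _)) ?(ltW A0) ?invr_ge0 ?exprn_ge0 ?(ltW b00).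
have [H [H0 mH HI HM]] := @maximal_estimate R n d alpha F S (fun x => `|omega x|) i0
  B K (p i0) r alpha0 FF SS (weight_nnm ow) B0 (le_trans ler01 K1) (p1 i0) r0
  (fun a l l0 => weight_cube a (sw i0) l0) FSfin
  (le_lt_trans (Fp i0) (ltry _))
  (fun a l l0 => testing_condition nd0 sw ow FF gPhi p1 pr c00 c10 b00 pPhi rPsi Fp AE a l0)
  (fun a l h l0 hh => Ainfty_integral_le (sw i0) KE l0 hh).
pose L := lux_constant * g * \prod_i lam i.
have lamp : 0 < \prod_i lam i by exact: prodr_gt0.
have L0 : 0 < L by rewrite !mulr_gt0// lux_constant_gt0.
apply: ereal_inf_lbound; exists L => //; split; first exact: L0.
set k := b1 * (\prod_i lam i / L) `^ r.
have k0 : 0 <= k by rewrite mulr_ge0 ?powR_ge0 ?(ltW b10).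
apply: (@le_trans _ _ (\int[leb]_x (k%:E * H x))%E).
  apply: le_integral_any => x _; first by rewrite mule_ge0 ?lee_fin.
  apply: (er_map_growth_le i0 lam0 sw cf FSfin gPsi rPsi r0 b10 L0 (H0 x)).
  by move=> a l l0 xa; exact: HM.
rewrite ge0_integralZl_EFin//.
apply: le_trans (lee_wpmul2l (_ : (0 <= k%:E)%E) HI) _; first by rewrite lee_fin.
have C0 : 0 <= grid_constant * (B * (2 * K * doob_constant)).
  have K0 : 0 <= 2 * K by rewrite mulr_ge0// (le_trans ler01).
  apply: mulr_ge0; first exact: ltW.
  by apply: mulr_ge0 => //; apply: mulr_ge0 => //; exact: ltW.
apply: le_trans (lee_wpmul2l (_ : (0 <= k%:E)%E)
  (lee_wpmul2l (_ : (0 <= (grid_constant * (B * (2 * K * doob_constant)))%:E)%E)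
    (Fp i0))) _; rewrite ?lee_fin//.
exact: (final_constant lux_constant_gt0 g0 lamp b00 b10 (c00 i0) r0 lux_constantE AK).
Qed.

End LuxemburgBound.

Theorem theorem3p12 (R : realType) (n d : nat) (alpha : R)
    (Phis : 'I_n -> R -> R) (Psi Phi : R -> R) (q : 'I_n -> R)
    (alpha_ge0 : 0 <= alpha) (alpha_lt : alpha < (n * d)%:R)
    (PhisU : forall i, Utilde (Phis i) /\ nabla2 (Phis i))
    (PsiU : Utilde Psi)
    (Phis_norm : forall i, normalized (Phis i)) (Psi_norm : normalized Psi)
    (Phi_bij : set_bij (Rplus) (Rplus) Phi)
    (Phi_inv : {in Rplus, forall t,
       ginv Phi t = \prod_(i < n) ginv (Phis i) t})
    (Psi_Phis : forall i,
       {in `]0, +oo[ &, {homo (fun t => Psi t / Phis i t) : s t / s <= t}})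
    (q_ge1 : forall i, 1 <= q i)
    (q_type : forall i, upper_type (q i) (Psi \o ginv (Phis i))) :
  exists2 C : R, 0 < C &
  forall (sigma : 'I_n -> Rd R d -> R) (omega : Rd R d -> R),
    (forall i, weight (sigma i)) -> weight omega ->
    (A_const alpha Phis Psi sigma omega < +oo)%E ->
    (forall i, Ainfty (sigma i)) ->
  forall f : 'I_n -> Rd R d -> R[i],
    (forall i, LPhi (Phis i) (sigma i) (f i)) ->
    (lux Psi omega
       (multi_maximal alpha (fun i x => ((sigma i x)%:C * f i x)%R))
     <= C%:E *
        er_map (ginv Psi) (A_const alpha Phis Psi sigma omega *
                           \prod_(i < n) (Ainfty_const (sigma i) `^ q i)) *
        \prod_(i < n) luxc (Phis i) (sigma i) (f i))%E.
Proof.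
have nd0 : (0 < n * d)%N.
  by rewrite -(ltr_nat R); exact: le_lt_trans alpha_lt.
have n0 : (0 < n)%N by move: nd0; rewrite muln_gt0 => /andP[].
pose i0 := Ordinal n0.
have gPsi : growth Psi by case: PsiU => ? _ [[]].
have gPhi i : growth (Phis i) by have [[? _ [[]]]] := PhisU i.
have [p /choice[c0 /choice[c1 P]]] := choice (fun i => Utilde_power_like (PhisU i).1).
have [r [b0 [b1 [_ b00 b10 rPsi]]]] := Utilde_power_like PsiU.
have c00 i : 0 < c0 i by have [] := P i.
have c10 i : 0 < c1 i by have [] := P i.
have pPhi i : power_like (p i) (c0 i) (c1 i) (Phis i) by have [] := P i.
have p1 i : 1 < p i.
  by have [pge1 _ _ _] := P i; exact: nabla2_gt1 (PhisU i).2 (c00 i) (pPhi i) pge1.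
have pr : p i0 <= r.
  exact: power_like_le_exponent (pPhi i0) rPsi (c00 i0) (c10 i0) b00 (Psi_Phis i0).
exists (lux_constant d i0 p c0 c1 r b0 b1).
  exact: lux_constant_gt0.
move=> sigma omega sw ow Afin Kfin f fL.
have A0 : (0 < A_const alpha Phis Psi sigma omega)%E by exact: A_const_gt0 rPsi _ _ sw ow.
have [A Apos AE] : exists2 A, 0 < A & A_const alpha Phis Psi sigma omega = A%:E.
  exists (fine (A_const alpha Phis Psi sigma omega)); first by rewrite fine_gt0// A0.
  by rewrite fineK// ge0_fin_numE// ltW.
have /choice[K KP] i : exists K, 1 <= K /\ Ainfty_const (sigma i) = K%:E.
  have K1 := Ainfty_const_ge1 (sw i).
  have Kf : Ainfty_const (sigma i) \is a fin_num.
    by rewrite ge0_fin_numE; [exact: Kfin|exact: le_trans K1].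
  by exists (fine (Ainfty_const (sigma i))); rewrite -lee_fin fineK.
have /choice[nu nuP] i : exists nu, luxc (Phis i) (sigma i) (f i) = nu%:E.
  exists (fine (luxc (Phis i) (sigma i) (f i))); rewrite fineK//.
  have [_ lfin] := fL i; rewrite ge0_fin_numE//.
  by apply: le_ereal_inf_tmp => _ [l [l0 _] <-]; rewrite lee_fin ltW.
pose D := A * \prod_i K i `^ q i; pose g := ginv Psi D.
have D0 : 0 < D.
  rewrite mulr_gt0// prodr_gt0// => i _; rewrite powR_gt0//.
  by have [K1 _] := KP i; exact: lt_le_trans K1.
have gge0 : 0 <= g by apply: ginv_ge0 => //; exact: ltW.
have Pg : Psi g = D by apply: ginvK => //; exact: ltW.
have g0 : 0 < g.
  rewrite lt_neqAle gge0 andbT; apply/eqP => e.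
  by move: D0; rewrite -Pg -e growth0// ltxx.
have AK : A * K i0 <= b1 * g `^ r.
  have /andP[_] := rPsi g gge0; rewrite Pg; apply: le_trans.
  rewrite ler_pM2l// (bigD1 i0)//=.
  have Kq i : 1 <= K i `^ q i.
    have [K1 _] := KP i; rewrite -[leLHS](powRr0 (K i)) ler_powR//.
    exact: le_trans (q_ge1 i).
  have Ki : K i0 <= K i0 `^ q i0.
    have [K1 _] := KP i0; rewrite -[leLHS]powRr1 ?(le_trans ler01)//.
    exact: ler_powR.
  apply: le_trans Ki _; rewrite ler_peMr ?powR_ge0//.
  by elim/big_ind: _ => // x y; exact: mulr_ege1.
rewrite AE (eq_bigr (fun i => (K i `^ q i)%:E)); last first.
  by move=> i _; have [_ ->] := KP i; rewrite poweR_EFin.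
rewrite [X in (_ <= _ * X)%E](eq_bigr (fun i => (nu i)%:E)); last first.
  by move=> i _; exact: nuP.
rewrite !prodEFin /= -!EFinM -/D -/g.
apply: le_prod_limit => e e0.
have /choice[lam lamP] i : exists l, [/\ 0 < l, l <= nu i + e &
    (\int[leb]_x (er_map (Phis i) (`|(cabs (f i x))%:E| * l^-1%:E)
     * (sigma i x)%:E) <= 1)%E].
  have : (luxc (Phis i) (sigma i) (f i) < (nu i + e)%:E)%E.
    by rewrite nuP lte_fin ltrDl.
  move=> /ereal_inf_lt[_ [l [l0 hl] <-]]; rewrite lte_fin => lt_l.
  by exists l; split=> //; exact: ltW.
apply: (@le_trans _ _ (lux_constant d i0 p c0 c1 r b0 b1 * g * \prod_i lam i)%:E).
  apply: (lux_maximal_le nd0 alpha_ge0 gPhi gPsi p1 pr c00 c10 b00 b10 pPhi rPsi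
    sw ow AE (KP i0).2 g0 AK).
  - by move=> i; have [] := fL i.
  - by move=> i; have [] := lamP i.
  - by move=> i; have [] := lamP i.
rewrite lee_fin ler_pM2l; last by rewrite mulr_gt0// lux_constant_gt0.
by apply: ler_prod => i _; have [l0 ln _] := lamP i; rewrite ln (ltW l0).
Qed.
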